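(* $\mathsf{CAC}$ does not prove $\mathsf{EM}$ over $\mathsf{RCA}_0$ (and hence $\mathsf{ADS}$ does not prove $\mathsf{EM}$ over $\mathsf{RCA}_0$ either).
   Context: All principles are statements of second order arithmetic; infinite structures have domain $\mathbb{N}$. $\mathsf{CAC}$: every infinite poset $M=(\mathbb{N},\preceq_M)$ contains an infinite chain (a set any two of whose elements are comparable) or an infinite antichain (a set any two distinct elements of which are incomparable). $\mathsf{ADS}$: for every infinite linear order $L=(\mathbb{N},<_L)$ there is an $f:\mathbb{N}\to\mathbb{N}$ with either $f(n)<_L f(m)$ for all $n<m$, or $f(n)>_L f(m)$ for all $n<m$. An infinite tournament is an irreflexive binary relation $T$ on $\mathbb{N}$ such that for all $x\neq y$ exactly one of $T(x,y)$, $T(y,x)$ holds. $\mathsf{EM}$: every infinite tournament $T$ contains an infinite transitive subtournament, i.e. an infinite set $S$ on which the relation $T$ is transitive. *)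

(* Defs.v *)
(* Second-order arithmetic as a two-sorted first-order theory with classical
   logic.  This file uses the Stdlib only. *)
From Stdlib Require Import List.
Import ListNotations.

(** * The language L2 *)

(* Variables are de Bruijn indices, in two independent index spaces: number
   quantifiers bind number indices only, set quantifiers set indices only.
   The only set terms are set variables, and equality is primitive between
   numbers only (equality of sets is extensional, hence definable). *)

Inductive term : Type :=
| var (x : nat)
| zero
| one
| plus (s t : term)
| times (s t : term).

Inductive form : Type :=
| eqF (s t : term)
| ltF (s t : term)
| memF (t : term) (X : nat)
| botF
| impF (p q : form)
| andF (p q : form)
| orF (p q : form)
| allN (p : form)
| exN (p : form)
| allS (p : form)
| exS (p : form).

Definition negF (p : form) : form := impF p botF.
Definition iffF (p q : form) : form := andF (impF p q) (impF q p).

Declare Scope l2_scope.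
Delimit Scope l2_scope with l2.
Bind Scope l2_scope with form.
Notation "s ≐ t" := (eqF s t) (at level 70, no associativity) : l2_scope.
Notation "s ≺ t" := (ltF s t) (at level 70, no associativity) : l2_scope.
Notation "t ∈ X" := (memF t X) (at level 70, no associativity) : l2_scope.
Notation "¬ p" := (negF p) (at level 75, right associativity) : l2_scope.
Notation "p ∧ q" := (andF p q) (at level 80, right associativity) : l2_scope.
Notation "p ∨ q" := (orF p q) (at level 85, right associativity) : l2_scope.
Notation "p ↔ q" := (iffF p q) (at level 95, no associativity) : l2_scope.
Notation "p → q" := (impF p q)
  (at level 99, q at level 200, right associativity) : l2_scope.
Local Open Scope l2_scope.

(** * Substitution *)

Definition scons {A : Type} (a : A) (f : nat -> A) (n : nat) : A :=
  match n with 0 => a | S m => f m end.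

Fixpoint substT (f : nat -> term) (t : term) : term :=
  match t with
  | var x => f x
  | zero => zero
  | one => one
  | plus s t => plus (substT f s) (substT f t)
  | times s t => times (substT f s) (substT f t)
  end.

Definition liftT : term -> term := substT (fun x => var (S x)).

Fixpoint substN (f : nat -> term) (p : form) : form :=
  match p with
  | eqF s t => eqF (substT f s) (substT f t)
  | ltF s t => ltF (substT f s) (substT f t)
  | memF t X => memF (substT f t) X
  | botF => botF
  | impF p q => impF (substN f p) (substN f q)
  | andF p q => andF (substN f p) (substN f q)
  | orF p q => orF (substN f p) (substN f q)
  | allN p => allN (substN (scons (var 0) (fun x => liftT (f x))) p)
  | exN p => exN (substN (scons (var 0) (fun x => liftT (f x))) p)
  | allS p => allS (substN f p)
  | exS p => exS (substN f p)
  end.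

Fixpoint substS (r : nat -> nat) (p : form) : form :=
  match p with
  | eqF s t => eqF s t
  | ltF s t => ltF s t
  | memF t X => memF t (r X)
  | botF => botF
  | impF p q => impF (substS r p) (substS r q)
  | andF p q => andF (substS r p) (substS r q)
  | orF p q => orF (substS r p) (substS r q)
  | allN p => allN (substS r p)
  | exN p => exN (substS r p)
  | allS p => allS (substS (scons 0 (fun X => S (r X))) p)
  | exS p => exS (substS (scons 0 (fun X => S (r X))) p)
  end.

Definition liftN : form -> form := substN (fun x => var (S x)).
Definition liftS : form -> form := substS S.
Definition instN (p : form) (t : term) : form := substN (scons t var) p.
Definition instS (p : form) (X : nat) : form := substS (scons X (fun Y => Y)) p.

(** * Provability *)

(* Classical natural deduction with equality.  The eigenvariable rules lift the
   hypotheses G but not the theory T: the free variables of an element of T are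
   implicitly universally quantified. *)

Inductive prv (T : form -> Prop) : list form -> form -> Prop :=
| prv_ax G p : T p -> prv T G p
| prv_hyp G p : In p G -> prv T G p
| prv_raa G p : prv T (negF p :: G) botF -> prv T G p
| prv_impI G p q : prv T (p :: G) q -> prv T G (impF p q)
| prv_impE G p q : prv T G (impF p q) -> prv T G p -> prv T G q
| prv_conjI G p q : prv T G p -> prv T G q -> prv T G (andF p q)
| prv_conjEl G p q : prv T G (andF p q) -> prv T G p
| prv_conjEr G p q : prv T G (andF p q) -> prv T G q
| prv_disjIl G p q : prv T G p -> prv T G (orF p q)
| prv_disjIr G p q : prv T G q -> prv T G (orF p q)
| prv_disjE G p q r :
    prv T G (orF p q) -> prv T (p :: G) r -> prv T (q :: G) r -> prv T G r
| prv_allNI G p : prv T (map liftN G) p -> prv T G (allN p)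
| prv_allNE G p t : prv T G (allN p) -> prv T G (instN p t)
| prv_exNI G p t : prv T G (instN p t) -> prv T G (exN p)
| prv_exNE G p q :
    prv T G (exN p) -> prv T (p :: map liftN G) (liftN q) -> prv T G q
| prv_allSI G p : prv T (map liftS G) p -> prv T G (allS p)
| prv_allSE G p X : prv T G (allS p) -> prv T G (instS p X)
| prv_exSI G p X : prv T G (instS p X) -> prv T G (exS p)
| prv_exSE G p q :
    prv T G (exS p) -> prv T (p :: map liftS G) (liftS q) -> prv T G q
| prv_refl G t : prv T G (eqF t t)
| prv_leibniz G p s t :
    prv T G (eqF s t) -> prv T G (instN p s) -> prv T G (instN p t).

Definition proves_over (T : form -> Prop) (p q : form) : Prop :=
  prv (fun r => T r \/ r = p) [] q.

(** * The system RCA_0 *)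

Inductive bounded : form -> Prop :=
| bounded_eqn s t : bounded (s ≐ t)
| bounded_lt s t : bounded (s ≺ t)
| bounded_mem t X : bounded (t ∈ X)
| bounded_bot : bounded botF
| bounded_imp p q : bounded p -> bounded q -> bounded (p → q)
| bounded_conj p q : bounded p -> bounded q -> bounded (p ∧ q)
| bounded_disj p q : bounded p -> bounded q -> bounded (p ∨ q)
| bounded_all t p : bounded p -> bounded (allN (var 0 ≺ liftT t → p))
| bounded_ex t p : bounded p -> bounded (exN (var 0 ≺ liftT t ∧ p)).

Definition sigma01 (p : form) : Prop := exists q, bounded q /\ p = exN q.
Definition pi01 (p : form) : Prop := exists q, bounded q /\ p = allN q.

(* [substN (scons (plus (var 0) one) (fun x => var (S x))) p] is p(n+1),
   for n the number variable 0. *)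
Definition induction (p : form) : form :=
  instN p zero
    ∧ allN (p → substN (scons (plus (var 0) one) (fun x => var (S x))) p)
  → allN p.

Definition comprehension (p q : form) : form :=
  allN (p ↔ q) → exS (allN (var 0 ∈ 0 ↔ liftS p)).

Inductive RCA0 : form -> Prop :=
| RCA0_succ_neq0 : RCA0 (¬ plus (var 0) one ≐ zero)
| RCA0_succ_inj :
    RCA0 (plus (var 0) one ≐ plus (var 1) one → var 0 ≐ var 1)
| RCA0_plus0 : RCA0 (plus (var 0) zero ≐ var 0)
| RCA0_plusS :
    RCA0 (plus (var 0) (plus (var 1) one) ≐ plus (plus (var 0) (var 1)) one)
| RCA0_times0 : RCA0 (times (var 0) zero ≐ zero)
| RCA0_timesS :
    RCA0 (times (var 0) (plus (var 1) one)
            ≐ plus (times (var 0) (var 1)) (var 0))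
| RCA0_lt0 : RCA0 (¬ var 0 ≺ zero)
| RCA0_ltS :
    RCA0 (var 0 ≺ plus (var 1) one ↔ var 0 ≺ var 1 ∨ var 0 ≐ var 1)
| RCA0_induction p : sigma01 p -> RCA0 (induction p)
| RCA0_comprehension p q :
    sigma01 p -> pi01 q -> RCA0 (comprehension p q).

(** * Combinatorial principles *)

(* A binary relation on N is coded by a set X, with x related to y when
   (x, y) is in X, for the pairing function (x, y) = (x + y)^2 + x. *)
Definition pairT (s t : term) : term :=
  plus (times (plus s t) (plus s t)) s.

Definition rel (X : nat) (s t : term) : form := pairT s t ∈ X.

Definition is_infinite (X : nat) : form :=
  allN (exN (var 1 ≺ var 0 ∧ var 0 ∈ X)).

Definition is_reflexive (X : nat) : form := allN (rel X (var 0) (var 0)).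

Definition is_irreflexive (X : nat) : form := allN (¬ rel X (var 0) (var 0)).

Definition is_antisymmetric (X : nat) : form :=
  allN (allN (rel X (var 1) (var 0) ∧ rel X (var 0) (var 1) → var 1 ≐ var 0)).

Definition is_transitive (X : nat) : form :=
  allN (allN (allN (rel X (var 2) (var 1) ∧ rel X (var 1) (var 0)
                      → rel X (var 2) (var 0)))).

Definition is_partial_order (X : nat) : form :=
  is_reflexive X ∧ is_antisymmetric X ∧ is_transitive X.

Definition is_chain (X Y : nat) : form :=
  allN (allN (var 1 ∈ Y ∧ var 0 ∈ Y
                → rel X (var 1) (var 0) ∨ rel X (var 0) (var 1))).

Definition is_antichain (X Y : nat) : form :=
  allN (allN (var 1 ∈ Y ∧ var 0 ∈ Y ∧ ¬ var 1 ≐ var 0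
                → ¬ (rel X (var 1) (var 0) ∨ rel X (var 0) (var 1)))).

(* In the principles below the universally quantified structure is set
   variable 0, and becomes set variable 1 under the set quantifier [exS]. *)
Definition CAC : form :=
  allS (is_partial_order 0
          → exS (is_infinite 0 ∧ (is_chain 1 0 ∨ is_antichain 1 0))).

Definition is_linear_order (X : nat) : form :=
  is_irreflexive X ∧ is_transitive X
    ∧ allN (allN (rel X (var 1) (var 0) ∨ var 1 ≐ var 0
                    ∨ rel X (var 0) (var 1))).

(* A function N -> N is coded by its graph. *)
Definition is_function (F : nat) : form :=
  allN (exN (rel F (var 1) (var 0)))
    ∧ allN (allN (allN (rel F (var 2) (var 1) ∧ rel F (var 2) (var 0)
                          → var 1 ≐ var 0))).

(* In the next two definitions, variables 3, 2, 1, 0 are n, m, F(n), F(m). *)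
Definition is_ascending (X F : nat) : form :=
  allN (allN (allN (allN
    (var 3 ≺ var 2 ∧ rel F (var 3) (var 1) ∧ rel F (var 2) (var 0)
       → rel X (var 1) (var 0))))).

Definition is_descending (X F : nat) : form :=
  allN (allN (allN (allN
    (var 3 ≺ var 2 ∧ rel F (var 3) (var 1) ∧ rel F (var 2) (var 0)
       → rel X (var 0) (var 1))))).

Definition ADS : form :=
  allS (is_linear_order 0
          → exS (is_function 0 ∧ (is_ascending 1 0 ∨ is_descending 1 0))).

Definition is_tournament (X : nat) : form :=
  is_irreflexive X
    ∧ allN (allN (¬ var 1 ≐ var 0
                    → (rel X (var 1) (var 0) ∨ rel X (var 0) (var 1))
                        ∧ ¬ (rel X (var 1) (var 0) ∧ rel X (var 0) (var 1)))).

Definition is_transitive_on (X Y : nat) : form :=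
  allN (allN (allN
    (var 2 ∈ Y ∧ var 1 ∈ Y ∧ var 0 ∈ Y
       → rel X (var 2) (var 1) ∧ rel X (var 1) (var 0)
       → rel X (var 2) (var 0)))).

Definition EM : form :=
  allS (is_tournament 0 → exS (is_infinite 0 ∧ is_transitive_on 1 0)).

(* Main.v *)
(* We build an omega-model of CAC and ADS in which EM fails; "c.e." below means
   definable by a [code], a countable class of positive existential conditions on
   the oracles closed under quantification over finite sets.

   The invariant is immunity against diagonalisation. Oracle 0 is a tournament, and
   oracle 1 enumerates finite sets [d] promised to be cut by every later vertex,
   so that no [d] lies in an infinite transitive set. [X] is [Good] if every c.e.
   relation that relates each [n] to some set of size at least [n] relates some
   [n] to an enumerated set. An infinite transitive set computes the relation "[d]
   is a subset of it", hence contradicts goodness.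

   The pair of oracles 0 and 1 is made good by a finite-extension construction. A
   requirement reserves a rank [e] before looking for a set of size [2e+2] to
   promise, so all promises can be kept simultaneously, by pairwise disjoint pairs.

   Goodness is preserved when solving a poset: build an ascending chain inside a
   c.e. reservoir. If a requirement cannot be met, then every chain meeting it has a
   last element with only finitely many reservoir elements above it, and these last
   elements form a c.e. infinite set. Within it, try a descending chain in
   the same way; a second failure leaves a c.e. infinite set whose elements are
   comparable with only finitely many others, where antichains always extend. *)
From Stdlib Require Import List Arith Lia Classical ClassicalEpsilon.
From Stdlib Require Import FunctionalExtensionality Cantor.
Import ListNotations.
Require Import Defs.

(** * Omega-models *)

(** A number assignment is a finite list, with 0 beyond its end, so that the parameters of a formula
    can be replaced by finitely many numerals inside a code. *)
Fixpoint tval (l : list nat) (t : term) : nat :=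
  match t with
  | var x => nth x l 0
  | zero => 0
  | one => 1
  | plus s t => tval l s + tval l t
  | times s t => tval l s * tval l t
  end.

Fixpoint sat (M : (nat -> bool) -> Prop) (l : list nat) (V : nat -> nat -> bool)
    (p : form) : Prop :=
  match p with
  | eqF s t => tval l s = tval l t
  | ltF s t => tval l s < tval l t
  | memF t X => V X (tval l t) = true
  | botF => False
  | impF p q => sat M l V p -> sat M l V q
  | andF p q => sat M l V p /\ sat M l V q
  | orF p q => sat M l V p \/ sat M l V q
  | allN p => forall n, sat M (n :: l) V p
  | exN p => exists n, sat M (n :: l) V p
  | allS p => forall Y, M Y -> sat M l (scons Y V) p
  | exS p => exists Y, M Y /\ sat M l (scons Y V) p
  end.

Lemma tval_substT f l l' t :
  (forall x, tval l (f x) = nth x l' 0) -> tval l (substT f t) = tval l' t.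
Proof. intros H; induction t; simpl; auto. Qed.

Lemma tval_liftT a l t : tval (a :: l) (liftT t) = tval l t.
Proof. apply tval_substT; reflexivity. Qed.

Lemma sat_substN M p : forall f l l' V,
  (forall x, tval l (f x) = nth x l' 0) ->
  sat M l V (substN f p) <-> sat M l' V p.
Proof.
  induction p; intros f l l' V H; simpl;
    try rewrite !(tval_substT f l l') by assumption; try reflexivity;
    try (rewrite (IHp1 f l l'), (IHp2 f l l') by assumption; reflexivity).
  1, 2: assert (E : forall n, sat M (n :: l) V
            (substN (scons (var 0) (fun x => liftT (f x))) p) <-> sat M (n :: l') V p)
    by (intros n; apply IHp; intros [|x]; simpl; [reflexivity | rewrite tval_liftT; auto]);
    firstorder.
  1, 2: assert (E : forall Y, sat M l (scons Y V) (substN f p) <-> sat M l' (scons Y V) p)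
    by (intros Y; apply IHp; assumption); firstorder.
Qed.

Lemma sat_substS M p : forall r l V V',
  (forall i, V (r i) = V' i) ->
  sat M l V (substS r p) <-> sat M l V' p.
Proof.
  induction p; intros r l V V' H; simpl; try rewrite H; try reflexivity;
    try (rewrite (IHp1 r l V V'), (IHp2 r l V V') by assumption; reflexivity).
  1, 2: assert (E : forall n, sat M (n :: l) V (substS r p) <-> sat M (n :: l) V' p)
    by (intros n; apply IHp; assumption); firstorder.
  1, 2: assert (E : forall Y, sat M l (scons Y V)
            (substS (scons 0 (fun X => S (r X))) p) <-> sat M l (scons Y V') p)
    by (intros Y; apply IHp; intros [|i]; simpl; auto); firstorder.
Qed.

Lemma sat_liftN M p n l V : sat M (n :: l) V (liftN p) <-> sat M l V p.
Proof. apply sat_substN; reflexivity. Qed.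

Lemma sat_liftS M p Y l V : sat M l (scons Y V) (liftS p) <-> sat M l V p.
Proof. apply sat_substS; reflexivity. Qed.

Lemma sat_instN M p t l V : sat M l V (instN p t) <-> sat M (tval l t :: l) V p.
Proof. apply sat_substN; intros [|x]; reflexivity. Qed.

Lemma sat_instS M p X l V : sat M l V (instS p X) <-> sat M l (scons (V X) V) p.
Proof. apply sat_substS; intros [|x]; reflexivity. Qed.

(** Elements of [T] must hold under every assignment because the eigenvariable rules do not lift
    them. *)
Lemma soundness M (T : form -> Prop) G p :
  (forall q, T q -> forall l V, (forall i, M (V i)) -> sat M l V q) ->
  prv T G p ->
  forall l V, (forall i, M (V i)) -> (forall q, In q G -> sat M l V q) -> sat M l V p.
Proof.
  intros HT D. induction D; intros l V HV HG; simpl in *.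
  - auto.
  - auto.
  - apply NNPP; intros N. apply (IHD l V HV). intros q [<-|Hq]; auto.
  - intros Hp. apply IHD; auto. intros r [<-|Hr]; auto.
  - apply (IHD1 l V HV HG), (IHD2 l V HV HG).
  - split; auto.
  - apply (IHD l V HV HG).
  - apply (IHD l V HV HG).
  - left; auto.
  - right; auto.
  - destruct (IHD1 l V HV HG); [apply IHD2 | apply IHD3]; auto;
      intros s [<-|Hs]; auto.
  - intros n. apply IHD; auto. intros q Hq.
    apply in_map_iff in Hq as (q' & <- & Hq'). apply sat_liftN; auto.
  - apply sat_instN, (IHD l V HV HG).
  - exists (tval l t). apply sat_instN; auto.
  - destruct (IHD1 l V HV HG) as [n Hn]. apply (sat_liftN M q n).
    apply IHD2; auto. intros r [<-|Hr]; auto.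
    apply in_map_iff in Hr as (r' & <- & Hr'). apply sat_liftN; auto.
  - intros Y HY. apply IHD; [intros [|i]; simpl; auto|]. intros q Hq.
    apply in_map_iff in Hq as (q' & <- & Hq'). apply sat_liftS; auto.
  - apply sat_instS, (IHD l V HV HG); auto.
  - exists (V X). split; auto. apply sat_instS; auto.
  - destruct (IHD1 l V HV HG) as (Y & HY & Hp). apply (sat_liftS M q Y).
    apply IHD2; [intros [|i]; simpl; auto|]. intros r [<-|Hr]; auto.
    apply in_map_iff in Hr as (r' & <- & Hr'). apply sat_liftS; auto.
  - reflexivity.
  - apply sat_instN. rewrite <- (IHD1 l V HV HG). apply sat_instN; auto.
Qed.

(** * Relative enumerability *)

Definition pr (x y : nat) : nat := (x + y) * (x + y) + x.

Definition unpr (z : nat) : nat * nat :=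
  let x := z - Nat.sqrt z * Nat.sqrt z in (x, Nat.sqrt z - x).

(** Since x <= 2(x + y), the number (x + y)^2 + x lies below (x + y + 1)^2, so its integer square
    root is x + y. Outside the range of [pr], [unpr] returns some harmless pair. *)
Lemma unpr_pr x y : unpr (pr x y) = (x, y).
Proof.
  unfold unpr, pr.
  assert (E : Nat.sqrt ((x + y) * (x + y) + x) = x + y)
    by (apply Nat.sqrt_unique; nia).
  rewrite E. f_equal; lia.
Qed.

Lemma unpr_le z : fst (unpr z) <= z /\ snd (unpr z) <= z.
Proof.
  unfold unpr; simpl. pose proof (Nat.sqrt_le_lin z). lia.
Qed.

(** Decoding by choice: only injectivity of an encoding has to be proved. *)
Definition inv {A B} (d : A) (f : A -> B) (b : B) : A :=
  epsilon (inhabits d) (fun a => f a = b).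

Lemma inv_inj {A B} (d : A) (f : A -> B) a :
  (forall a a', f a = f a' -> a = a') -> inv d f (f a) = a.
Proof.
  intros H. apply H. unfold inv.
  apply (epsilon_spec (inhabits d) (fun a' => f a' = f a)). eauto.
Qed.

Lemma to_nat_inj p q : to_nat p = to_nat q -> p = q.
Proof.
  intros E. rewrite <- (cancel_of_to p), <- (cancel_of_to q), E. reflexivity.
Qed.

Lemma to_nat2_inj a b c d : to_nat (a, b) = to_nat (c, d) -> a = c /\ b = d.
Proof. intros E. apply to_nat_inj in E. injection E; auto. Qed.

Fixpoint enc_list (l : list nat) : nat :=
  match l with [] => 0 | x :: l => S (to_nat (x, enc_list l)) end.

Lemma enc_list_inj l l' : enc_list l = enc_list l' -> l = l'.
Proof.
  revert l'; induction l as [|x l IH]; intros [|x' l'] E;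
    cbn [enc_list] in E; try discriminate; auto.
  injection E as E. apply to_nat2_inj in E as [-> E]. f_equal; auto.
Qed.

Definition ls : nat -> list nat := inv [] enc_list.

Lemma ls_enc l : ls (enc_list l) = l.
Proof. apply inv_inj, enc_list_inj. Qed.

Lemma le_list_max l x : In x l -> x <= list_max l.
Proof.
  assert (F : Forall (fun y => y <= list_max l) l) by (apply list_max_le; auto).
  rewrite Forall_forall in F. apply F.
Qed.

Definition mem (l : list nat) (x : nat) : bool :=
  if in_dec Nat.eq_dec x l then true else false.

Lemma mem_In l x : mem l x = true <-> In x l.
Proof. unfold mem. destruct in_dec; intuition discriminate. Qed.

Definition big (n d : nat) : Prop := n <= length (nodup Nat.eq_dec (ls d)).

Definition upd (X : nat -> nat -> bool) (j : nat) (G : nat -> bool) : nat -> nat -> bool :=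
  fun i => if Nat.eq_dec i j then G else X i.

Definition agree (k : nat) (X X' : nat -> nat -> bool) : Prop :=
  forall i x, i < k -> x < k -> X i x = X' i x.

Lemma upd_eq X j G : upd X j G j = G.
Proof. unfold upd. destruct Nat.eq_dec; congruence. Qed.

Lemma upd_neq X j G i : i <> j -> upd X j G i = X i.
Proof. unfold upd. destruct Nat.eq_dec; congruence. Qed.

Lemma agree_upd k X X' j G : agree k X X' -> agree k (upd X j G) (upd X' j G).
Proof. intros H i x Hi Hx. unfold upd. destruct Nat.eq_dec; auto. Qed.

Lemma agree_le k k' X X' : k <= k' -> agree k' X X' -> agree k X X'.
Proof. intros H A i x ? ?. apply A; lia. Qed.

Lemma agree_upd2 k X j G G' :
  (forall x, x < k -> G x = G' x) -> agree k (upd X j G) (upd X j G').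
Proof. intros H i x Hi Hx. unfold upd. destruct Nat.eq_dec; auto. Qed.

Definition count (S : nat -> bool) (y : nat) : nat := length (filter S (seq 0 y)).

(* The graph of the increasing enumeration of [S]. *)
Definition graph (S : nat -> bool) (z : nat) : bool :=
  let (n, y) := unpr z in (S y && (count S y =? n))%bool.

Lemma graph_ext S S' z : (forall x, x <= z -> S x = S' x) -> graph S z = graph S' z.
Proof.
  intros H. pose proof (unpr_le z) as [_ Hy]. unfold graph.
  destruct (unpr z) as [n y]; simpl in Hy. unfold count. rewrite (H y Hy).
  rewrite (filter_ext_in S S'); auto.
  intros a Ha. apply in_seq in Ha. apply H; lia.
Qed.

(** There is no negation, but oracles may be queried both ways. [cGraph] puts the increasing
    enumeration of each oracle into the model, as sequences for [ADS]. [cFin] evaluates a code with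
    oracle [j] replaced by a finite set, so that a code can search through finite extensions. [cSub]
    changes the number environment. *)
Inductive code : Type :=
| cLt (s t : term)
| cMem (b : bool) (t : term) (i : nat)
| cGraph (b : bool) (t : term) (i : nat)
| cAnd (p q : code)
| cOr (p q : code)
| cEx (p : code)
| cAllLt (t : term) (p : code)
| cAllIn (t : term) (p : code)
| cFin (j : nat) (s t : term) (p : code)
| cSub (ts : list term) (p : code).

Fixpoint eval (c : code) (l : list nat) (X : nat -> nat -> bool) : Prop :=
  match c with
  | cLt s t => tval l s < tval l t
  | cMem b t i => X i (tval l t) = b
  | cGraph b t i => graph (X i) (tval l t) = b
  | cAnd p q => eval p l X /\ eval q l X
  | cOr p q => eval p l X \/ eval q l X
  | cEx p => exists n, eval p (n :: l) X
  | cAllLt t p => forall n, n < tval l t -> eval p (n :: l) X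
  | cAllIn t p => forall n, In n (ls (tval l t)) -> eval p (n :: l) X
  | cFin j s t p => eval p l (upd X j (mem (ls (tval l s) ++ ls (tval l t))))
  | cSub ts p => eval p (map (tval l) ts) X
  end.

Lemma choose_bound (P : nat -> nat -> Prop) (L : list nat) :
  (forall x k k', k <= k' -> P x k -> P x k') ->
  (forall x, In x L -> exists k, P x k) -> exists k, forall x, In x L -> P x k.
Proof.
  intros mono; induction L as [|a L IH]; intros H.
  - exists 0; intros x [].
  - destruct IH as [k Hk]; [intros; apply H; right; auto|].
    destruct (H a) as [k' Hk']; [left; auto|].
    exists (k + k'). intros x [<-|Hx].
    + apply (mono a k'); [lia|auto].
    + apply (mono x k); [lia|auto].
Qed.

(** The use principle: a true code needs one witness for each existential quantifier and finitely
    many instances of each bounded one, hence finitely many oracle values. *)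
Lemma eval_use c : forall l X, eval c l X ->
  exists k, forall X', agree k X X' -> eval c l X'.
Proof.
  induction c; intros l X H; simpl in H.
  - exists 0; auto.
  - exists (S (i + tval l t)). intros X' A. simpl. rewrite <- A by lia. auto.
  - exists (S (i + tval l t)). intros X' A. simpl. rewrite <- H. symmetry.
    apply graph_ext. intros x Hx. apply A; lia.
  - destruct H as [H1 H2].
    apply IHc1 in H1 as [k1 H1]; apply IHc2 in H2 as [k2 H2].
    exists (k1 + k2). intros X' A.
    split; [apply H1 | apply H2]; eapply agree_le; try exact A; lia.
  - destruct H as [H|H]; [apply IHc1 in H | apply IHc2 in H]; destruct H as [k H];
      exists k; intros; simpl; auto.
  - destruct H as [n H]. apply IHc in H as [k H]. exists k. intros. exists n. auto.
  - destruct (choose_bound (fun n k => forall X', agree k X X' -> eval c (n :: l) X')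
      (seq 0 (tval l t))) as [k Hk].
    + intros x k k' Hk HP X' A. apply HP. eapply agree_le; eauto.
    + intros x Hx. apply in_seq in Hx. apply IHc, H; lia.
    + exists k. intros X' A n Hn. apply Hk; auto. apply in_seq; lia.
  - destruct (choose_bound (fun n k => forall X', agree k X X' -> eval c (n :: l) X')
      (ls (tval l t))) as [k Hk].
    + intros x k k' Hk HP X' A. apply HP. eapply agree_le; eauto.
    + intros x Hx. apply IHc, H; auto.
    + exists k. intros X' A n Hn. apply Hk; auto.
  - apply IHc in H as [k H]. exists k. intros X' A. apply H, agree_upd, A.
  - apply IHc in H as [k H]. exists k. intros X' A. apply H, A.
Qed.

(** A code mentions finitely many oracles, so a code over infinitely many oracles can be read at a
    finite stage of their construction. *)
Lemma eval_supp c : exists N, forall l X X',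
  (forall i, i < N -> X i = X' i) -> eval c l X <-> eval c l X'.
Proof.
  induction c; simpl.
  - exists 0; reflexivity.
  - exists (S i). intros l X X' H. rewrite (H i) by lia. reflexivity.
  - exists (S i). intros l X X' H. rewrite (H i) by lia. reflexivity.
  - destruct IHc1 as [N1 H1], IHc2 as [N2 H2]. exists (N1 + N2). intros l X X' H.
    rewrite (H1 l X X'), (H2 l X X') by (intros; apply H; lia). reflexivity.
  - destruct IHc1 as [N1 H1], IHc2 as [N2 H2]. exists (N1 + N2). intros l X X' H.
    rewrite (H1 l X X'), (H2 l X X') by (intros; apply H; lia). reflexivity.
  - destruct IHc as [N HN]. exists N. intros l X X' H.
    split; intros [n Hn]; exists n; apply (HN _ X X' H), Hn.
  - destruct IHc as [N HN]. exists N. intros l X X' H.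
    split; intros A n Hn; apply (HN _ X X' H), A, Hn.
  - destruct IHc as [N HN]. exists N. intros l X X' H.
    split; intros A n Hn; apply (HN _ X X' H), A, Hn.
  - destruct IHc as [N HN]. exists N. intros l X X' H. apply HN.
    intros i Hi. unfold upd. destruct Nat.eq_dec; auto.
  - destruct IHc as [N HN]. exists N. intros l X X' H. apply HN, H.
Qed.

(** * Numbering of codes *)

Fixpoint enc_term (t : term) : nat :=
  match t with
  | var x => to_nat (0, x)
  | zero => to_nat (1, 0)
  | one => to_nat (1, 1)
  | plus s t => to_nat (2, to_nat (enc_term s, enc_term t))
  | times s t => to_nat (3, to_nat (enc_term s, enc_term t))
  end.

Ltac decode :=
  repeat match goal with
  | E : to_nat (_, _) = to_nat (_, _) |- _ => apply to_nat2_inj in E as []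
  end; try discriminate.

Opaque to_nat.

Lemma enc_term_inj t t' : enc_term t = enc_term t' -> t = t'.
Proof.
  revert t'; induction t; intros [] E; simpl in E; decode; subst; auto;
    f_equal; auto.
Qed.

Lemma enc_terms_inj ts ts' :
  enc_list (map enc_term ts) = enc_list (map enc_term ts') -> ts = ts'.
Proof.
  intros E. apply enc_list_inj in E. revert ts' E.
  induction ts; intros [] E; try discriminate; auto.
  injection E as E1 E2. apply enc_term_inj in E1. f_equal; auto.
Qed.

Fixpoint enc (c : code) : nat :=
  match c with
  | cLt s t => to_nat (0, to_nat (enc_term s, enc_term t))
  | cMem b t i => to_nat (1, to_nat (Nat.b2n b, to_nat (enc_term t, i)))
  | cGraph b t i => to_nat (2, to_nat (Nat.b2n b, to_nat (enc_term t, i)))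
  | cAnd p q => to_nat (3, to_nat (enc p, enc q))
  | cOr p q => to_nat (4, to_nat (enc p, enc q))
  | cEx p => to_nat (5, enc p)
  | cAllLt t p => to_nat (6, to_nat (enc_term t, enc p))
  | cAllIn t p => to_nat (7, to_nat (enc_term t, enc p))
  | cFin j s t p =>
      to_nat (8, to_nat (j, to_nat (enc_term s, to_nat (enc_term t, enc p))))
  | cSub ts p => to_nat (9, to_nat (enc_list (map enc_term ts), enc p))
  end.

Lemma b2n_inj b b' : Nat.b2n b = Nat.b2n b' -> b = b'.
Proof. destruct b, b'; simpl; congruence. Qed.

Lemma enc_inj c c' : enc c = enc c' -> c = c'.
Proof.
  revert c'; induction c; intros [] E; cbn [enc] in E; decode; subst; f_equal;
    auto using enc_term_inj, b2n_inj, enc_terms_inj.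
Qed.

Definition dec : nat -> code := inv (cLt zero zero) enc.

Lemma dec_enc c : dec (enc c) = c.
Proof. apply inv_inj, enc_inj. Qed.

Fixpoint num (n : nat) : term :=
  match n with 0 => zero | S n => plus (num n) one end.

Lemma tval_num l n : tval l (num n) = n.
Proof. induction n; simpl; lia. Qed.

Lemma tval_nums l m : map (tval l) (map num m) = m.
Proof. induction m; simpl; rewrite ?tval_num; congruence. Qed.

(* [W X d]: according to the enumeration [X 1], the finite set [ls d] has no
   extension to an infinite transitive set. *)
Definition W (X : nat -> nat -> bool) (d : nat) : Prop :=
  exists s, X 1 (pr d s) = true.

Definition cW (t : term) : code :=
  cEx (cMem true (pairT (liftT t) (var 0)) 1).

Lemma eval_cW t l X : eval (cW t) l X <-> W X (tval l t).
Proof.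
  unfold cW, W. simpl. split; intros [s H]; exists s.
  all: rewrite !tval_liftT in *; exact H.
Qed.

Definition Good (X : nat -> nat -> bool) : Prop :=
  forall c, (forall n, exists d, big n d /\ eval c [n; d] X) ->
  exists n d, eval c [n; d] X /\ W X d.

(** The common skeleton of both forcing constructions: [I] is well-formedness, [R] is extension, and
    [D m] says that requirement [m] is met, which happens at stage m + 1. *)
Lemma dependent_sequence {A} (I : A -> Prop) (R : A -> A -> Prop)
    (D : nat -> A -> Prop) (a0 : A) :
  (forall a, I a -> R a a) -> (forall a b c, R a b -> R b c -> R a c) -> I a0 ->
  (forall m a, I a -> exists b, I b /\ R a b /\ D m b) ->
  exists f : nat -> A, f 0 = a0 /\ (forall m, I (f m)) /\
    (forall m n, m <= n -> R (f m) (f n)) /\ (forall m, D m (f (S m))).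
Proof.
  intros Rr Rt I0 St.
  pose (F := fun m a => epsilon (inhabits a0) (fun b => I b /\ R a b /\ D m b)).
  assert (HF : forall m a, I a -> I (F m a) /\ R a (F m a) /\ D m (F m a)).
  { intros m a Ia. apply (epsilon_spec (inhabits a0) (fun b => I b /\ R a b /\ D m b)).
    auto. }
  pose (f := fix f m := match m with 0 => a0 | S m => F m (f m) end).
  assert (HI : forall m, I (f m)).
  { induction m; simpl; auto. apply HF; auto. }
  exists f. split; [reflexivity|]. split; [auto|]. split.
  - intros m n H. induction H; auto. apply (Rt _ (f m0)); auto. apply HF; auto.
  - intros m. apply HF; auto.
Qed.

(** * A good tournament *)

Lemma fresh_element (D S : list nat) :
  NoDup D -> length S < length D -> exists a, In a D /\ ~ In a S.
Proof.
  intros ND L. apply NNPP; intros N.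
  assert (I : incl D S).
  { intros a Ha. apply NNPP; intros H. apply N; eauto. }
  pose proof (NoDup_incl_length ND I). lia.
Qed.

(* A vertex [y] with [y -> x] iff [A x = false] closes a cycle with two
   elements of [ls d]. *)
Definition cuts (t : nat -> nat -> bool) (d : nat) (A : nat -> bool) : Prop :=
  exists a b, In a (ls d) /\ In b (ls d) /\ t a b = true /\ A b = true /\ A a = false.

(* The set of rank [e] has two elements outside the at most [2e] elements used
   by the sets of smaller rank. *)
Lemma cut_all (t : nat -> nat -> bool) (act : nat -> nat -> Prop) (N : nat) :
  (forall e d d', act e d -> act e d' -> d = d') ->
  (forall e d, act e d -> big (2 * e + 2) d) ->
  (forall e d a b, act e d -> In a (ls d) -> In b (ls d) -> a <> b ->
     t a b = true \/ t b a = true) ->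
  (forall e d, act e d -> e < N) ->
  exists A, forall e d, act e d -> cuts t d A.
Proof.
  intros Hf Hb Ht HN.
  assert (H : forall n, exists A S, length S <= 2 * n /\
    forall e d, act e d -> e < n -> exists a b, In a S /\ In b S /\
      In a (ls d) /\ In b (ls d) /\ t a b = true /\ A b = true /\ A a = false).
  { induction n as [|n (A & S & HS & HA)].
    - exists (fun _ => false), []. split; [simpl; lia|]. intros; lia.
    - destruct (classic (exists d, act n d)) as [[d Hd]|Hno].
      + pose proof (Hb _ _ Hd) as B. unfold big in B.
        assert (ND := NoDup_nodup Nat.eq_dec (ls d)).
        destruct (fresh_element _ S ND) as (a & Ha & HaS); [lia|].
        destruct (fresh_element _ (a :: S) ND) as (b & Hb' & HbS); [simpl; lia|].
        apply nodup_In in Ha. apply nodup_In in Hb'.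
        assert (Hab : a <> b) by (intros ->; apply HbS; left; auto).
        assert (HbS' : ~ In b S) by (intros ?; apply HbS; right; auto).
        assert (E : exists a b, In a (ls d) /\ In b (ls d) /\ a <> b /\
                      ~ In a S /\ ~ In b S /\ t a b = true).
        { destruct (Ht n d a b Hd Ha Hb' Hab); [exists a, b | exists b, a]; auto 10. }
        clear a b Ha Hb' HaS HbS Hab HbS'.
        destruct E as (a & b & Ha & Hb' & Hab & HaS & HbS & Tab).
        (* Both a and b lie outside [S], so the values already committed for smaller ranks
           survive. *)
        exists (fun x => if x =? b then true else if x =? a then false else A x),
          (a :: b :: S).
        split; [simpl; lia|]. intros e d' He Le.
        destruct (Nat.eq_dec e n) as [->|Ne].
        * rewrite (Hf _ _ _ He Hd). exists a, b. simpl.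
          rewrite !Nat.eqb_refl. rewrite (proj2 (Nat.eqb_neq a b) Hab). auto 10.
        * destruct (HA e d' He) as (a' & b' & Ha' & Hb2 & R1 & R2 & R3 & R4 & R5); [lia|].
          exists a', b'. repeat (split; [simpl; auto; fail|]).
          assert (Q : forall x, In x S -> (x =? b) = false /\ (x =? a) = false).
          { intros x Hx. split; apply Nat.eqb_neq; intros ->; auto. }
          destruct (Q _ Ha') as [-> ->], (Q _ Hb2) as [-> ->]. auto.
      + exists A, S. split; [lia|]. intros e d He Le. apply (HA e d); auto.
        destruct (Nat.eq_dec e n) as [->|]; [|lia]. exfalso; eauto. }
  destruct (H N) as (A & S & _ & HA). exists A. intros e d He.
  destruct (HA e d He (HN e d He)) as (a & b & Q). exists a, b. tauto.
Qed.

(** * The tournament determined by a sequence of promises *)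

(* [p s = Some (e, d)] promises that every vertex [y > s] cuts [ls d]. *)
Definition promises : Type := nat -> option (nat * nat).

Definition kills (t : nat -> nat -> bool) (L : list (option (nat * nat)))
    (A : nat -> bool) : Prop :=
  forall e d, In (Some (e, d)) L -> cuts t d A.

(** The edges between a new vertex and the older ones: some choice that cuts every set in [L] if
    there is one, and arbitrary otherwise. *)
Definition orientation (t : nat -> nat -> bool) (L : list (option (nat * nat))) :
    nat -> bool :=
  epsilon (inhabits (fun _ => false)) (kills t L).

(* The tournament restricted to the vertices below [n]. *)
Fixpoint tour (p : promises) (n : nat) : nat -> nat -> bool :=
  match n with
  | 0 => fun _ _ => false
  | S y => fun a b =>
      let A := orientation (tour p y) (map p (seq 0 y)) in
      if b =? y then ((a <? y) && A a)%bool
      else if a =? y then ((b <? y) && negb (A b))%bool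
      else tour p y a b
  end.

Definition T (p : promises) (a b : nat) : bool := tour p (S (a + b)) a b.

Lemma tour_stable p n a b : a < n -> b < n -> tour p n a b = T p a b.
Proof.
  assert (H : forall m n, a < n -> b < n -> tour p (m + n) a b = tour p n a b).
  { intros m n' Ha Hb. induction m; auto. cbn [tour Nat.add]. rewrite <- IHm.
    rewrite (proj2 (Nat.eqb_neq a _)), (proj2 (Nat.eqb_neq b _)) by lia. auto. }
  intros Ha Hb. unfold T. rewrite <- (H (S (a + b)) n), <- (H n (S (a + b))) by lia.
  f_equal; lia.
Qed.

Lemma T_last p x y : x < y ->
  T p x y = orientation (tour p y) (map p (seq 0 y)) x /\
  T p y x = negb (orientation (tour p y) (map p (seq 0 y)) x).
Proof.
  intros H. rewrite <- (tour_stable p (S y) x y), <- (tour_stable p (S y) y x) by lia.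
  cbn [tour]. rewrite Nat.eqb_refl, (proj2 (Nat.eqb_neq x y)) by lia.
  rewrite (proj2 (Nat.ltb_lt x y) H). auto.
Qed.

Lemma T_irrefl p x : T p x x = false.
Proof.
  rewrite <- (tour_stable p (S x)) by lia. cbn [tour].
  rewrite Nat.eqb_refl, Nat.ltb_irrefl. reflexivity.
Qed.

Lemma T_total p x y : x <> y -> T p y x = negb (T p x y).
Proof.
  intros H. destruct (Nat.lt_trichotomy x y) as [L|[L|L]]; [|lia|];
    apply (T_last p) in L as [-> ->]; rewrite ?Bool.negb_involutive; auto.
Qed.

Definition coherent (p : promises) (k : nat) (p' : promises) : Prop :=
  forall s, s < k -> p s = p' s.

Lemma tour_coherent p p' n : coherent p n p' -> tour p n = tour p' n.
Proof.
  induction n; intros H; auto. cbn [tour].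
  rewrite IHn by (intros s Hs; apply H; lia).
  rewrite (map_ext_in p p'); auto.
  intros s Hs. apply in_seq in Hs. apply H; lia.
Qed.

Definition ground (p : promises) : nat -> nat -> bool := fun i z =>
  let (x, y) := unpr z in
  match i with
  | 0 => T p x y
  | 1 => match p y with Some (_, d) => d =? x | None => false end
  | _ => false
  end.

(** A pair coded below k has both components below k, and edges between vertices below k depend only
    on promises made before stage k. *)
Lemma ground_coherent p p' k : coherent p k p' -> agree k (ground p) (ground p').
Proof.
  intros H i z _ Hz. unfold ground. pose proof (unpr_le z) as [Hx Hy].
  destruct (unpr z) as [x y]; simpl in *.
  destruct i as [|[|i]]; auto.
  - rewrite <- !(tour_stable _ k) by lia. rewrite (tour_coherent p p' k); auto.
  - rewrite H by lia. auto.
Qed.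

Lemma ground_T p x y : ground p 0 (pr x y) = T p x y.
Proof. unfold ground. rewrite unpr_pr. reflexivity. Qed.

Lemma ground_W p d : W (ground p) d <-> exists s e, p s = Some (e, d).
Proof.
  unfold W, ground. split.
  - intros [s H]. rewrite unpr_pr in H. exists s.
    destruct (p s) as [[e d']|]; [|discriminate].
    apply Nat.eqb_eq in H as ->. eauto.
  - intros (s & e & H). exists s. rewrite unpr_pr, H. apply Nat.eqb_refl.
Qed.

(** One promise per rank lets [cut_all] allot two elements to each rank. The bound x < s ensures
    that a vertex above s finds all edges inside the promised set already fixed. *)
Definition valid (p : promises) : Prop :=
  (forall s s' e d d', p s = Some (e, d) -> p s' = Some (e, d') -> s = s') /\
  (forall s e d, p s = Some (e, d) ->
     big (2 * e + 2) d /\ forall x, In x (ls d) -> x < s).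

(** The promises made before y satisfy the hypotheses of [cut_all], so [orientation] does cut all of
    them, and y closes the cycle a -> b -> y -> a. *)
Lemma valid_cuts p s e d y : valid p -> p s = Some (e, d) -> s < y ->
  exists a b, In a (ls d) /\ In b (ls d) /\
    T p a b = true /\ T p b y = true /\ T p y a = true.
Proof.
  intros [V1 V2] Hs Hy.
  set (L := map p (seq 0 y)).
  assert (HL : forall e d, In (Some (e, d)) L -> exists s, s < y /\ p s = Some (e, d)).
  { intros e' d' H. apply in_map_iff in H as (s' & E & H). apply in_seq in H.
    exists s'. split; [lia|auto]. }
  assert (K : kills (tour p y) L (orientation (tour p y) L)).
  { unfold orientation. apply epsilon_spec.
    destruct (choose_bound (fun s n => forall e d, p s = Some (e, d) -> e < n)
                (seq 0 y)) as [N HN].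
    - intros x k k' Hk H e' d' E. apply H in E; lia.
    - intros x _. destruct (p x) as [[e' d']|].
      + exists (S e'). intros e2 d2 E. injection E as -> ->; lia.
      + exists 0. discriminate.
    - apply (cut_all (tour p y) (fun e d => In (Some (e, d)) L) N).
      + intros e' d1 d2 H1 H2.
        apply HL in H1 as (s1 & _ & H1). apply HL in H2 as (s2 & _ & H2).
        rewrite (V1 _ _ _ _ _ H1 H2) in H1. congruence.
      + intros e' d' H. apply HL in H as (s' & _ & H). apply (V2 _ _ _ H).
      + intros e' d' a b H Ha Hb Hab. apply HL in H as (s' & Hs' & H).
        apply V2 in H as [_ H]. apply H in Ha. apply H in Hb.
        rewrite !tour_stable by lia. rewrite (T_total p a b Hab).
        destruct (T p a b); auto.
      + intros e' d' H. apply HL in H as (s' & Hs' & H).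
        apply (HN s') with d'; auto. apply in_seq; lia. }
  destruct (K e d) as (a & b & Ha & Hb & Tab & Ab & Aa).
  { apply in_map_iff. exists s. split; auto. apply in_seq; lia. }
  assert (Hlt : forall x, In x (ls d) -> x < y).
  { intros x Hx. apply (proj2 (V2 _ _ _ Hs)) in Hx. lia. }
  exists a, b. repeat (split; [auto; fail|]).
  rewrite tour_stable in Tab by auto.
  destruct (T_last p a y (Hlt a Ha)) as [_ ->], (T_last p b y (Hlt b Hb)) as [-> _].
  fold L. rewrite Ab, Aa. auto.
Qed.

(** * Finite-extension forcing of goodness *)

(* A finite sequence of promises of length [len], and a finite set of ranks which
   later promises may not use. *)
Record cond : Type := Cond { prom : promises; len : nat; used : list nat }.

Definition wf (q : cond) : Prop :=
  valid (prom q) /\ forall s e d, prom q s = Some (e, d) -> s < len q /\ In e (used q).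

Definition ext (q q' : cond) : Prop :=
  len q <= len q' /\ incl (used q) (used q') /\ coherent (prom q) (len q) (prom q') /\
  forall s e d, len q <= s -> prom q' s = Some (e, d) -> ~ In e (used q).

Lemma ext_refl q : wf q -> ext q q.
Proof.
  intros [_ H]. repeat split; auto using incl_refl.
  intros s e d Hs E. apply H in E as []. lia.
Qed.

Lemma ext_trans q1 q2 q3 : ext q1 q2 -> ext q2 q3 -> ext q1 q3.
Proof.
  intros (A1 & A2 & A3 & A4) (B1 & B2 & B3 & B4). repeat split.
  - lia.
  - eapply incl_tran; eauto.
  - intros s Hs. rewrite A3, B3 by lia. auto.
  - intros s e d Hs E. destruct (le_lt_dec (len q2) s) as [L|L].
    + intros H. apply (B4 s e d L E), A2, H.
    + apply (A4 s e d Hs). rewrite B3; auto.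
Qed.

Definition captures (c : code) (p : promises) : Prop :=
  exists n d, eval c [n; d] (ground p) /\ W (ground p) d.

Definition hits (c : code) (e : nat) (p : promises) : Prop :=
  exists d, big (2 * e + 2) d /\ eval c [2 * e + 2; d] (ground p).

(** The first case secures the conclusion of [Good] for [c] in every continuation. The second
    refutes its hypothesis at n = 2e + 2, since a suitable set would, by the use principle, already
    appear at some later condition. *)
Definition decided (c : code) (q : cond) : Prop :=
  (forall p, coherent (prom q) (len q) p -> captures c p) \/
  exists e, forall q', wf q' -> ext q q' -> ~ hits c e (prom q').

(** The rank e is reserved before the search, so an extension that hits [c] has made no promise of
    rank e, and the set found can be promised at that rank. *)
Lemma decide_code c q m : wf q ->
  exists q', wf q' /\ ext q q' /\ m <= len q' /\ decided c q'.
Proof.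
  intros Hq.
  assert (W1 : forall f n, len q <= n -> (forall x, In x (used q) -> In x f) ->
     wf (Cond (prom q) n f) /\ ext q (Cond (prom q) n f)).
  { intros f n Hn Hf. destruct Hq as [V H]. split; [split|]; simpl; auto.
    - intros s e d E. apply H in E as []. split; [lia|auto].
    - repeat split; simpl; auto.
      intros s e d Hs E. apply H in E as []; lia. }
  set (e := S (list_max (used q))).
  assert (He : ~ In e (used q)).
  { intros H. apply le_list_max in H. lia. }
  set (q0 := Cond (prom q) (max m (len q)) (e :: used q)).
  destruct (W1 (e :: used q) (max m (len q))) as [Wq0 Eq0]; [lia|right; auto|].
  fold q0 in Wq0, Eq0.
  destruct (classic (exists q', wf q' /\ ext q0 q' /\ hits c e (prom q'))) as
    [(q1 & Wq1 & Eq1 & d & Bd & Ev)|Hno].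
  2: { exists q0. split; [exact Wq0|]. split; [exact Eq0|]. split; [simpl; lia|].
       right. exists e. intros q' ? ? ?. apply Hno. eauto. }
  apply eval_use in Ev as [k Hk].
  (* The new promise comes after the use k, so the computation is preserved, after everything fixed
     by [q1], and after all elements of [ls d], as validity requires. *)
  set (s := k + len q1 + S (list_max (ls d))).
  set (p := fun i => if Nat.eq_dec i s then Some (e, d) else prom q1 i).
  assert (Ps : p s = Some (e, d)) by (unfold p; destruct Nat.eq_dec; congruence).
  assert (Pn : forall i, i <> s -> p i = prom q1 i)
    by (intros i Hi; unfold p; destruct Nat.eq_dec; congruence).
  assert (Ne : forall i d', prom q1 i <> Some (e, d')).
  { intros i d' E. destruct Eq1 as (L1 & _ & C1 & N1).
    destruct (le_lt_dec (len q0) i) as [L|L].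
    - apply (N1 i e d' L E). left; auto.
    - rewrite <- C1 in E by auto. apply (proj2 Hq) in E as []. auto. }
  destruct Eq1 as (L1 & U1 & C1 & N1). destruct Wq1 as [[V1 V2] V3].
  exists (Cond p (S s) (used q1)).
  assert (Wf : wf (Cond p (S s) (used q1))).
  { split; [split|]; simpl.
    - intros i i' e' d1 d2 E1 E2.
      destruct (Nat.eq_dec i s) as [->|Hi], (Nat.eq_dec i' s) as [->|Hi']; auto.
      + rewrite Ps in E1. rewrite Pn in E2 by auto. injection E1 as <- <-.
        apply Ne in E2 as [].
      + rewrite Ps in E2. rewrite Pn in E1 by auto. injection E2 as <- <-.
        apply Ne in E1 as [].
      + rewrite Pn in E1, E2 by auto. eauto.
    - intros i e' d' E. destruct (Nat.eq_dec i s) as [->|Hi].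
      + rewrite Ps in E. injection E as <- <-. split; auto.
        intros x Hx.
        apply le_list_max in Hx. unfold s. lia.
      + rewrite Pn in E by auto. eauto.
    - intros i e' d' E. destruct (Nat.eq_dec i s) as [->|Hi].
      + rewrite Ps in E. injection E as <- <-. split; [lia|].
        apply U1. left; auto.
      + rewrite Pn in E by auto. apply V3 in E as []. split; auto. unfold s. lia. }
  split; [exact Wf|]. split; [|split].
  - simpl in L1. repeat split; simpl.
    + unfold s. lia.
    + intros x Hx. apply U1. right; auto.
    + intros i Hi. rewrite Pn by (unfold s; lia). apply C1. simpl. lia.
    + intros i e' d' Hi E Hin. destruct (Nat.eq_dec i s) as [->|Hi'].
      * rewrite Ps in E. injection E as <- <-. auto.
      * rewrite Pn in E by auto. destruct (le_lt_dec (len q0) i) as [L|L].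
        -- apply (N1 i e' d' L E). right; auto.
        -- rewrite <- C1 in E by auto. apply (proj2 Hq) in E as []. lia.
  - simpl in *. unfold s. lia.
  - left. intros p' Hp'. simpl in Hp'. exists (2 * e + 2), d. split.
    + apply Hk, ground_coherent. intros i Hi. rewrite <- Hp' by (unfold s; lia).
      rewrite Pn by (unfold s; lia). auto.
    + apply ground_W. exists s, e. rewrite <- Hp' by lia. auto.
Qed.

Lemma good_ground : exists p, valid p /\ Good (ground p).
Proof.
  destruct (dependent_sequence wf ext (fun m q => m <= len q /\ decided (dec m) q)
              (Cond (fun _ => None) 0 [])) as (f & _ & Hw & He & Hd).
  - exact ext_refl.
  - exact ext_trans.
  - repeat split; simpl; discriminate.
  - intros m q Hq. destruct (decide_code (dec m) q m Hq) as (q' & ? & ? & ? & ?).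
    exists q'. auto.
  (* Stage s + 2 has length at least s + 1, so it has settled the promise at s. *)
  - set (p := fun s => prom (f (S (S s))) s).
    assert (L : forall m, m <= len (f (S m))) by (intros; apply Hd).
    assert (C : forall m, coherent (prom (f m)) (len (f m)) p).
    { intros m s Hs. unfold p.
      destruct (Nat.le_ge_cases m (S (S s))) as [H|H].
      - apply (He m (S (S s)) H); auto.
      - symmetry. apply (He _ _ H). pose proof (L (S s)). lia. }
    assert (Ap : forall k, exists m, k <= m /\ coherent p k (prom (f m))).
    { intros k. exists (S k). split; [lia|]. intros s Hs. symmetry. apply C.
      pose proof (L k). lia. }
    assert (V : valid p).
    { split.
      - intros s s' e d d' E E'. destruct (Ap (S (s + s'))) as (m & _ & H).
        rewrite H in E, E' by lia. apply (proj1 (proj1 (Hw m)) _ _ _ _ _ E E').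
      - intros s e d E. destruct (Ap (S s)) as (m & _ & H).
        rewrite H in E by lia. apply (proj2 (proj1 (Hw m)) _ _ _ E). }
    exists p. split; [exact V|]. intros c Hc.
    destruct (Hd (enc c)) as [_ [H|(e & H)]]; rewrite dec_enc in H; [apply H, C|].
    (* A hit in the limit has finite use, hence is a hit at a late enough condition of the sequence,
       against the choice of e. *)
    exfalso. destruct (Hc (2 * e + 2)) as (d & Bd & Ev).
    apply eval_use in Ev as [k Hk].
    destruct (Ap (k + S (enc c))) as (m & Hm & Cm).
    apply (H (f m)); auto.
    + apply He. lia.
    + exists d. split; auto. apply Hk, ground_coherent.
      intros s Hs. apply Cm; lia.
Qed.

(** * Good chains and antichains *)

Definition ce (X : nat -> nat -> bool) (S : nat -> Prop) : Prop :=
  exists c, forall x, S x <-> eval c [x] X.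

Definition ce2 (X : nat -> nat -> bool) (Q : nat -> nat -> Prop) : Prop :=
  exists c, forall x y, Q x y <-> eval c [x; y] X.

Definition unbounded (S : nat -> Prop) : Prop := forall b, exists y, b <= y /\ S y.

Definition clique (Q : nat -> nat -> Prop) (S : nat -> Prop) : Prop :=
  forall x y, S x -> S y -> x < y -> Q x y.

(** The disjunction y < x + 1 or Q x y replaces an implication, so that this is literally the
    meaning of a code. *)
Definition lclique (Q : nat -> nat -> Prop) (l : list nat) : Prop :=
  forall x, In x l -> forall y, In y l -> y < x + 1 \/ Q x y.

Lemma lclique_iff Q l : lclique Q l <-> clique Q (fun x => In x l).
Proof.
  split; intros H x; [intros y Hx Hy L; destruct (H x Hx y Hy); [lia|auto]|].
  intros Hx y Hy. destruct (le_lt_dec y x); [left; lia | right; apply H; auto].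
Qed.

(** Membership in a finite set is a query to oracle 0 after replacing it by that set; [t] occurs
    twice because [cFin] concatenates two lists. *)
Definition cIn (s t : term) : code := cFin 0 t t (cMem true s 0).

Lemma eval_cIn s t l X : eval (cIn s t) l X <-> In (tval l s) (ls (tval l t)).
Proof. simpl. rewrite upd_eq, mem_In, in_app_iff. tauto. Qed.

Lemma ce_above X R b : ce X R -> ce X (fun y => R y /\ b <= y).
Proof.
  intros [c H]. exists (cAnd c (cLt (num b) (plus (var 0) one))).
  intros y. simpl. rewrite <- H, tval_num. intuition lia.
Qed.

Lemma ce_and X R S : ce X R -> ce X S -> ce X (fun y => R y /\ S y).
Proof.
  intros [c H] [c' H']. exists (cAnd c c'). intros y. simpl. rewrite H, H'. tauto.
Qed.

Lemma ce_common X Q f : ce2 X Q -> ce X (fun y => forall x, In x (ls f) -> x < y /\ Q x y).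
Proof.
  intros [c H].
  exists (cAllIn (num f) (cAnd (cLt (var 0) (var 1)) c)).
  intros y. simpl. rewrite tval_num. setoid_rewrite H. tauto.
Qed.

Lemma ce_finite_clique X Q R : ce2 X Q -> ce X R ->
  ce X (fun f => (forall x, In x (ls f) -> R x) /\ lclique Q (ls f)).
Proof.
  intros [c H] [c' H'].
  exists (cAnd (cAllIn (var 0) (cSub [var 0] c'))
    (cAllIn (var 0) (cAllIn (var 1)
      (cOr (cLt (var 0) (plus (var 1) one)) (cSub [var 1; var 0] c))))).
  intros f. simpl. unfold lclique. setoid_rewrite H. setoid_rewrite H'. tauto.
Qed.

Lemma ce_nonempty X : ce X (fun f => exists x, In x (ls f)).
Proof.
  exists (cEx (cIn (var 0) (var 1))). intros f.
  cbn [eval]. split; intros [x Hx]; exists x.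
  - apply eval_cIn, Hx.
  - apply eval_cIn in Hx. exact Hx.
Qed.

Definition with_finite (X : nat -> nat -> bool) (j : nat) (s l : list nat) :
    nat -> nat -> bool := upd X j (mem (s ++ l)).

(** What is forced by some finite extension from a c.e. family is again c.e. in [X], so that
    goodness of [X] can be applied to it. *)
Lemma ce2_finite_extension X j s (Z : nat -> Prop) c : ce X Z ->
  exists c', forall n d, eval c' [n; d] X <->
    exists f, Z f /\ eval c [n; d] (with_finite X j s (ls f)).
Proof.
  intros [z Hz].
  exists (cEx (cAnd (cSub [var 0] z)
     (cFin j (num (enc_list s)) (var 0) (cSub [var 1; var 2] c)))).
  intros n d. simpl. setoid_rewrite tval_num. setoid_rewrite ls_enc. setoid_rewrite Hz.
  reflexivity.
Qed.

Lemma ce_captured X j s c :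
  ce X (fun f => exists n d, eval c [n; d] (with_finite X j s (ls f)) /\ W X d).
Proof.
  exists (cEx (cEx (cAnd
     (cFin j (num (enc_list s)) (var 2) (cSub [var 1; var 0] c)) (cW (var 0))))).
  intros f. cbn [eval]. setoid_rewrite eval_cW. simpl.
  setoid_rewrite tval_num. setoid_rewrite ls_enc. reflexivity.
Qed.

(** * Mathias forcing with c.e. reservoirs *)

(* A finite clique and a reservoir for its later elements. *)
Definition mcond : Type := list nat * (nat -> Prop).

Definition mwf X (Q : nat -> nat -> Prop) (R0 : nat -> Prop) (q : mcond) : Prop :=
  ce X (snd q) /\ unbounded (snd q) /\ (forall y, snd q y -> R0 y) /\
  (forall x, In x (fst q) -> R0 x) /\ lclique Q (fst q) /\
  forall x y, In x (fst q) -> snd q y -> x < y /\ Q x y.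

Definition mext (q q' : mcond) : Prop :=
  incl (fst q) (fst q') /\ (forall x, In x (fst q') -> In x (fst q) \/ snd q x) /\
  forall y, snd q' y -> snd q y.

Lemma mext_refl q : mext q q.
Proof. repeat split; auto using incl_refl. Qed.

Lemma mext_trans q1 q2 q3 : mext q1 q2 -> mext q2 q3 -> mext q1 q3.
Proof.
  intros (A1 & A2 & A3) (B1 & B2 & B3). repeat split; auto.
  - eapply incl_tran; eauto.
  - intros x Hx. apply B2 in Hx as [Hx|Hx]; auto.
Qed.

Lemma mwf_thin X Q R0 s R b : mwf X Q R0 (s, R) ->
  mwf X Q R0 (s, fun y => R y /\ b <= y).
Proof.
  intros (A1 & A2 & A3 & A4 & A5 & A6). simpl in *.
  unfold mwf; cbn [fst snd]. split; [apply ce_above; auto|].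
  split; [|split; [|split; [|split]]]; auto.
  - intros b'. destruct (A2 (b + b')) as (y & Hy & Ry). exists y.
    repeat split; auto; lia.
  - intros y []; auto.
  - intros x y Hx []; auto.
Qed.

Lemma mwf_extend X Q R0 s R f : ce2 X Q -> mwf X Q R0 (s, R) ->
  (forall x, In x (ls f) -> R x) -> lclique Q (ls f) ->
  unbounded (fun y => R y /\ forall x, In x (ls f) -> Q x y) ->
  mwf X Q R0 (s ++ ls f, fun y => R y /\ forall x, In x (ls f) -> x < y /\ Q x y).
Proof.
  intros HQ (A1 & A2 & A3 & A4 & A5 & A6) F1 F2 F3. simpl in *.
  unfold mwf; cbn [fst snd]. split; [apply ce_and, ce_common; auto|].
  split; [|split; [|split; [|split]]].
  - intros b. destruct (F3 (b + S (list_max (ls f)))) as (y & Hy & Ry & Qy). exists y.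
    split; [lia|]. split; auto. intros x Hx. split; auto.
    apply le_list_max in Hx. lia.
  - intros y []; auto.
  - intros x Hx. apply in_app_iff in Hx as []; auto.
  - intros x Hx y Hy. apply in_app_iff in Hx as [Hx|Hx]; apply in_app_iff in Hy as [Hy|Hy];
      auto.
    + right. apply A6; auto.
    + left. pose proof (A6 y x Hy (F1 x Hx)). lia.
  - intros x y Hx [Ry Hy]. apply in_app_iff in Hx as [Hx|Hx]; auto.
Qed.

(** The combinatorial demand of the forcing on [Q]: a c.e. search [Z] that succeeds arbitrarily far
    out has a success that can be added to the clique while the reservoir stays infinite. *)
Definition extendible X (Q : nat -> nat -> Prop) (R0 : nat -> Prop) : Prop :=
  forall R Z, ce X R -> (forall y, R y -> R0 y) -> unbounded R -> ce X Z ->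
    (forall f, Z f -> (exists x, In x (ls f)) /\ (forall x, In x (ls f) -> R x) /\
       lclique Q (ls f)) ->
    (forall b, exists f, Z f /\ forall x, In x (ls f) -> b <= x) ->
  exists f, Z f /\ unbounded (fun y => R y /\ forall x, In x (ls f) -> Q x y).

(** The search is for any nonempty finite clique in the reservoir above b; singletons show that it
    succeeds arbitrarily far out. *)
Lemma add_element X Q R0 q b : ce2 X Q -> extendible X Q R0 -> mwf X Q R0 q ->
  exists q', mwf X Q R0 q' /\ mext q q' /\ exists x, In x (fst q') /\ b <= x.
Proof.
  intros HQ HE Hq. destruct q as [s R].
  pose proof (mwf_thin _ _ _ _ _ b Hq) as (A1 & A2 & A3 & A4 & A5 & A6).
  cbn [fst snd] in *. set (R' := fun y => R y /\ b <= y) in *.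
  destruct (HE R' (fun f => (exists x, In x (ls f)) /\
     ((forall x, In x (ls f) -> R' x) /\ lclique Q (ls f)))) as (f & (E1 & E2 & E3) & E4);
    auto.
  - apply ce_and; [apply ce_nonempty | apply ce_finite_clique; auto].
  - intros b'. destruct (A2 b') as (y & Hy & Ry). exists (enc_list [y]).
    rewrite ls_enc. split; [split; [|split]|].
    + exists y; left; auto.
    + intros x [<-|[]]; exact Ry.
    + intros x [<-|[]] z [<-|[]]. left; lia.
    + intros x [<-|[]]; auto.
  - exists (s ++ ls f, fun y => R' y /\ forall x, In x (ls f) -> x < y /\ Q x y).
    split; [|split].
    + apply mwf_extend; auto. apply mwf_thin, Hq.
    + repeat split; cbn [fst snd].
      * apply incl_appl, incl_refl.
      * intros x Hx. apply in_app_iff in Hx as [Hx|Hx]; auto. right. apply E2, Hx.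
      * intros y [[] _]; auto.
    + destruct E1 as [x Hx]. exists x. split; [|apply E2, Hx].
      cbn [fst]. apply in_app_iff. auto.
Qed.

(** In the first case the reservoir starts beyond the use [k], so later elements cannot disturb the
    captured computation. In the second the hypothesis of [Good] will fail at n. *)
Definition mdecided X (Q : nat -> nat -> Prop) (j : nat) (c : code) (q : mcond) : Prop :=
  (exists k n d, (forall y, snd q y -> k <= y) /\ W X d /\
     forall G, (forall x, x < k -> G x = mem (fst q) x) -> eval c [n; d] (upd X j G)) \/
  (exists n, forall d f, big n d -> (forall x, In x (ls f) -> snd q x) ->
     lclique Q (ls f) -> ~ eval c [n; d] (with_finite X j (fst q) (ls f))).

(* Either extensions by arbitrarily late finite cliques force the requirement, or
   thinning the reservoir forces its failure. *)
Lemma decide_requirement X Q R0 j c q : Good X -> ce2 X Q -> extendible X Q R0 ->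
  mwf X Q R0 q ->
  exists q', mwf X Q R0 q' /\ mext q q' /\ mdecided X Q j c q'.
Proof.
  intros HX HQ HE Hq. destruct q as [s R].
  assert (Thin : forall b, mext (s, R) (s, fun y => R y /\ b <= y)).
  { intros b. repeat split; cbn [fst snd]; auto using incl_refl. intros y []; auto. }
  assert (Use : forall f n d, eval c [n; d] (with_finite X j s (ls f)) -> exists k,
     forall G, (forall x, x < k -> G x = mem (s ++ ls f) x) -> eval c [n; d] (upd X j G)).
  { intros f n d H. apply eval_use in H as [k Hk]. exists k. intros G HG.
    apply Hk, agree_upd2. intros x Hx. symmetry; auto. }
  set (Zb := fun b f => (forall x, In x (ls f) -> R x /\ b <= x) /\ lclique Q (ls f)).
  assert (CZ : forall b, ce X (Zb b)).
  { intros b. apply ce_finite_clique; auto. apply ce_above, Hq. }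
  destruct (classic (exists b n, forall d, big n d ->
     ~ exists f, Zb b f /\ eval c [n; d] (with_finite X j s (ls f)))) as [(b & n & H)|Htot].
  { exists (s, fun y => R y /\ b <= y). split; [apply mwf_thin, Hq|].
    split; [apply Thin|]. right. exists n. intros d f Bd Hf Cf Ev.
    apply (H d Bd). exists f. split; [split|]; auto. }
  set (Cap := fun f => exists n d, eval c [n; d] (with_finite X j s (ls f)) /\ W X d).
  assert (Late : forall b, exists f, Zb b f /\ Cap f).
  (* Goodness of [X] is applied to the relation forced by some finite clique of the reservoir above
     b: one such clique relates some n to an enumerated set. *)
  { intros b. destruct (ce2_finite_extension X j s (Zb b) c (CZ b)) as [v Hv].
    destruct (HX v) as (n & d & Ev & Wd).
    - intros n. apply NNPP; intros N. apply Htot. exists b, n. intros d Bd Hf.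
      apply N. exists d. split; auto. apply Hv, Hf.
    - apply Hv in Ev as (f & Zf & Ev). exists f. split; auto. exists n, d. auto. }
  (* [extendible] handles nonempty cliques only; if the empty extension already captures, the clique
     [s] stays as it is. *)
  destruct (classic (exists f, ls f = [] /\ Cap f)) as [(f & E & n & d & Ev & Wd)|NE].
  { destruct (Use f n d Ev) as [k Hk]. rewrite E, app_nil_r in Hk.
    exists (s, fun y => R y /\ k <= y). split; [apply mwf_thin, Hq|].
    split; [apply Thin|]. left. exists k, n, d. cbn [fst snd].
    repeat split; auto. intros y []; auto. }
  pose proof Hq as (A1 & A2 & A3 & _). cbn [fst snd] in A1, A2, A3.
  destruct (HE R (fun f => Zb 0 f /\ Cap f)) as (f & [[F1 F2] (n & d & Ev & Wd)] & Un);
    auto.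
  - apply ce_and; auto. apply ce_captured.
  - intros f [[F1 F2] Cf]. split; [|split]; auto.
    + destruct (ls f) as [|x l] eqn:E; [|exists x; left; auto].
      exfalso. eauto.
    + intros x Hx. apply F1, Hx.
  - intros b. destruct (Late b) as (f & [F1 F2] & Cf). exists f.
    split; [split; [split|]|]; auto.
    + intros x Hx. split; [apply F1, Hx | lia].
    + intros x Hx. apply F1, Hx.
  - destruct (Use f n d Ev) as [k Hk].
    set (R' := fun y => R y /\ forall x, In x (ls f) -> x < y /\ Q x y).
    exists (s ++ ls f, fun y => R' y /\ k <= y). split; [|split].
    + apply mwf_thin, mwf_extend; auto. intros x Hx. apply F1, Hx.
    + repeat split; cbn [fst snd].
      * apply incl_appl, incl_refl.
      * intros x Hx. apply in_app_iff in Hx as [Hx|Hx]; auto. right. apply F1, Hx.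
      * intros y [[] _]; auto.
    + left. exists k, n, d. cbn [fst snd]. repeat split; auto. intros y []; auto.
Qed.

Definition of_prop (P : nat -> Prop) (x : nat) : bool :=
  if excluded_middle_informative (P x) then true else false.

Lemma of_prop_true P x : of_prop P x = true <-> P x.
Proof. unfold of_prop. destruct excluded_middle_informative; intuition discriminate. Qed.

Lemma of_prop_false P x : of_prop P x = false <-> ~ P x.
Proof. unfold of_prop. destruct excluded_middle_informative; intuition discriminate. Qed.

Lemma W_upd X j G d : 2 <= j -> W (upd X j G) d <-> W X d.
Proof. intros H. unfold W. rewrite upd_neq by lia. reflexivity. Qed.

Lemma generic_clique X Q R0 j : 2 <= j -> Good X -> ce2 X Q -> ce X R0 -> unbounded R0 ->
  extendible X Q R0 ->
  exists G, unbounded (fun x => G x = true) /\ clique Q (fun x => G x = true) /\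
    Good (upd X j G).
Proof.
  intros Hj HX HQ CR UR HE.
  destruct (dependent_sequence (mwf X Q R0) mext
    (fun m q => (exists x, In x (fst q) /\ m <= x) /\ mdecided X Q j (dec m) q) ([], R0))
    as (f & _ & Hw & He & Hd).
  - intros; apply mext_refl.
  - exact mext_trans.
  - unfold mwf; cbn [fst snd].
    split; [auto|]. split; [auto|]. split; [auto|]. split; [intros x []|].
    split; [intros x []|intros x y []].
  - intros m q Hq.
    destruct (add_element X Q R0 q m HQ HE Hq) as (q1 & W1 & E1 & x & Hx & Lx).
    destruct (decide_requirement X Q R0 j (dec m) q1 HX HQ HE W1) as (q2 & W2 & E2 & D2).
    exists q2. split; auto. split; [eapply mext_trans; eauto|]. split; auto.
    exists x. split; auto. apply E2, Hx.
  - set (P := fun x => exists m, In x (fst (f m))).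
    assert (PG : forall x, of_prop P x = true <-> P x) by (intros; apply of_prop_true).
    assert (PC : clique Q P).
    { intros x y [m Hx] [m' Hy] L.
      apply (He m (m + m')) in Hx; [|lia]. apply (He m' (m + m')) in Hy; [|lia].
      destruct (Hw (m + m')) as (_ & _ & _ & _ & C & _).
      destruct (C x Hx y Hy); [lia|auto]. }
    assert (PR : forall m x, P x -> In x (fst (f m)) \/ snd (f m) x).
    { intros m x [m' Hx]. destruct (Nat.le_ge_cases m m') as [L|L].
      - apply (He _ _ L), Hx.
      - left. apply (He _ _ L), Hx. }
    exists (of_prop P). split; [|split].
    + intros b. destruct (Hd b) as [(x & Hx & L) _]. exists x. split; auto.
      apply PG. exists (S b). auto.
    + intros x y Hx Hy. apply PC; apply PG; auto.
    + intros c Hc. destruct (Hd (enc c)) as [_ D]. rewrite dec_enc in D.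
      set (q := f (S (enc c))) in *.
      destruct D as [(k & n & d & Hk & Wd & Ev)|(n & H)].
      * exists n, d. split; [|apply W_upd; auto]. apply Ev. intros x Lx.
        apply Bool.eq_iff_eq_true. rewrite PG, mem_In. split.
        -- intros Px. destruct (PR (S (enc c)) x Px) as [?|Hx]; auto.
           apply Hk in Hx. lia.
        -- intros Hx. exists (S (enc c)). auto.
      * exfalso. destruct (Hc n) as (d & Bd & Ev).
        apply eval_use in Ev as [k Hk].
        (* [F] is the part of the limit below the use that is not yet in the clique of stage [q]: a
           finite clique in its reservoir giving the same computation. *)
        set (F := filter (fun x => of_prop P x && negb (mem (fst q) x))%bool (seq 0 k)).
        assert (HF : forall x, In x F <-> x < k /\ P x /\ ~ In x (fst q)).
        { intros x. unfold F. rewrite filter_In, in_seq, Bool.andb_true_iff,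
            Bool.negb_true_iff, PG, <- mem_In.
          destruct (mem (fst q) x); intuition (try lia; try discriminate). }
        apply (H d (enc_list F) Bd); rewrite ls_enc.
        -- intros x Hx. apply HF in Hx as (_ & Px & Nx).
           destruct (PR (S (enc c)) x Px); auto. contradiction.
        -- apply lclique_iff. intros x y Hx Hy. apply HF in Hx. apply HF in Hy.
           apply PC; tauto.
        -- apply Hk. intros i x Hi Lx. unfold with_finite, upd.
           destruct Nat.eq_dec; auto. apply Bool.eq_iff_eq_true.
           rewrite PG, mem_In, in_app_iff, HF. split.
           ++ intros Px. destruct (classic (In x (fst q))); auto.
           ++ intros [Hx|(_ & Px & _)]; auto. exists (S (enc c)). auto.
Qed.

Lemma not_unbounded S : ~ unbounded S -> exists b, forall y, S y -> y < b.
Proof.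
  intros H. apply NNPP; intros N. apply H. intros b. apply NNPP; intros N'.
  apply N. exists b. intros y Sy. destruct (le_lt_dec b y); auto. exfalso; eauto.
Qed.

(* If no later element keeps infinitely many candidates, the last elements of the
   finite cliques found by the search form the second alternative. *)
Lemma chain_or_sparse X Q R0 j : 2 <= j -> Good X -> ce2 X Q -> ce X R0 -> unbounded R0 ->
  (forall x y z, Q x y -> Q y z -> Q x z) ->
  (exists G, unbounded (fun x => G x = true) /\ clique Q (fun x => G x = true) /\
     Good (upd X j G)) \/
  (exists D, ce X D /\ unbounded D /\ (forall x, D x -> R0 x) /\
     forall z, D z -> ~ unbounded (fun y => D y /\ Q z y)).
Proof.
  intros Hj HX HQ CR UR Tr. apply NNPP; intros N. apply not_or_and in N as [N1 N2].
  apply N1, (generic_clique X Q R0 j); auto.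
  intros R Z CR' RR UR' [z Hz] HZ Late.
  (* [D] collects the largest elements of the cliques in [Z], which are also their [Q]-last
     elements. *)
  set (D := fun y => exists f, Z f /\ In y (ls f) /\ forall x, In x (ls f) -> x < y + 1).
  assert (CD : ce X D).
  { exists (cEx (cAnd (cSub [var 0] z) (cAnd (cIn (var 1) (var 0))
        (cAllIn (var 0) (cLt (var 0) (plus (var 2) one)))))).
    intros y. cbn [eval]. setoid_rewrite eval_cIn. simpl. unfold D. setoid_rewrite Hz.
    reflexivity. }
  assert (UD : unbounded D).
  { intros b. destruct (Late b) as (f & Zf & Lf). destruct (HZ f Zf) as ((x & Hx) & _).
    exists (list_max (ls f)).
    assert (Ne : ls f <> []) by (intros E; rewrite E in Hx; destruct Hx).
    assert (M : In (list_max (ls f)) (ls f)).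
    { clear - Ne. induction (ls f) as [|a l IH]; [congruence|].
      change (list_max (a :: l)) with (Nat.max a (list_max l)).
      destruct l as [|a' l]; [left; simpl; lia|].
      destruct (Nat.max_spec a (list_max (a' :: l))) as [[_ ->]|[_ ->]].
      - right. apply IH. discriminate.
      - left; auto. }
    split; [apply Lf, M|]. exists f. split; auto. split; auto. intros y Hy.
    apply le_list_max in Hy. lia. }
  assert (DR : forall y, D y -> R y).
  { intros y (f & Zf & Hy & _). apply (HZ f Zf), Hy. }
  apply NNPP; intros N. apply N2. exists D. repeat split; auto.
  (* By transitivity, whatever is above the last element y is above all of [ls f], so [f] would be
     the member of [Z] demanded by [extendible]. *)
  intros y Dy Uy. apply N. destruct Dy as (f & Zf & Hy & Ly). exists f. split; auto.
  intros b. destruct (Uy b) as (w & Hw & Dw & Qw). exists w. repeat split; auto.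
  intros x Hx. destruct (Nat.eq_dec x y) as [->|Ne]; auto. apply (Tr x y w); auto.
  destruct (HZ f Zf) as (_ & _ & C). destruct (C x Hx y Hy); auto.
  pose proof (Ly x Hx). lia.
Qed.

(** * Homogeneous sets for transitive relations *)

Definition homogeneous (le : nat -> nat -> Prop) (S : nat -> Prop) : Prop :=
  clique le S \/ clique (fun x y => le y x) S \/
  clique (fun x y => ~ le x y /\ ~ le y x) S.

Lemma ce2_flip X Q : ce2 X Q -> ce2 X (fun x y => Q y x).
Proof.
  intros [c H]. exists (cSub [var 1; var 0] c). intros x y. apply H.
Qed.

Lemma solve_poset X le j : 2 <= j -> Good X -> ce2 X le -> ce2 X (fun x y => ~ le x y) ->
  (forall x y z, le x y -> le y z -> le x z) ->
  exists G, unbounded (fun x => G x = true) /\ homogeneous le (fun x => G x = true) /\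
    Good (upd X j G).
Proof.
  intros Hj HX C1 C2 Tr.
  destruct (chain_or_sparse X le (fun _ => True) j) as
    [(G & U & C & HG)|(D1 & CD1 & UD1 & _ & F1)]; auto.
  { exists (cLt zero one). simpl. intros; split; auto. }
  { intros b; exists b; auto. }
  { exists G. split; [auto|]. split; [left; auto|auto]. }
  destruct (chain_or_sparse X (fun x y => le y x) D1 j) as
    [(G & U & C & HG)|(D & CD & UD & DD & F2)]; auto.
  { apply ce2_flip, C1. }
  { intros x y z H1 H2. eauto. }
  { exists G. split; [auto|]. split; [right; left; auto|auto]. }
  destruct (generic_clique X (fun x y => ~ le x y /\ ~ le y x) D j) as (G & U & C & HG);
    auto.
  { destruct (ce2_flip _ _ C2) as [c' Hc']. destruct C2 as [c Hc].
    exists (cAnd c c'). intros x y. simpl. rewrite <- Hc, <- Hc'. reflexivity. }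
  (* Any member of [Z] will do: each element of [D] has finitely many elements of [D] above it by
     [F1] and below it by [F2]. *)
  { intros R Z CR RR UR _ HZ Late. destruct (Late 0) as (f & Zf & _). exists f.
    split; auto.
    destruct (choose_bound (fun x b => forall y, D y -> le x y \/ le y x -> y < b) (ls f))
      as [b Hb].
    - intros x k k' Hk H y Dy Hy. apply H in Hy; auto; lia.
    - intros x Hx. assert (Dx : D x) by (apply RR; apply (HZ f Zf), Hx).
      destruct (not_unbounded (fun y => D1 y /\ le x y)) as [b1 H1].
      { apply F1; auto. }
      destruct (not_unbounded _ (F2 x Dx)) as [b2 H2].
      exists (b1 + b2). intros y Dy [L|L].
      + assert (y < b1) by auto. lia.
      + assert (y < b2) by auto. lia.
    - intros b'. destruct (UR (b + b')) as (y & Hy & Ry). exists y.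
      split; [lia|]. split; auto. intros x Hx.
      assert (Hn : ~ (le x y \/ le y x)) by (intros H; apply (Hb x Hx) in H; auto; lia).
      tauto. }
  exists G. split; [auto|]. split; [right; right; auto|auto].
Qed.

(** * The model *)

(** An instance is a transitive relation given with a code for its complement, which covers partial
    orders and strict linear orders alike. Other pairs of codes are solved vacuously, so all pairs
    can be listed uniformly. *)
Definition solves (cp cn : code) (X : nat -> nat -> bool) (G : nat -> bool) : Prop :=
  (forall x y, eval cn [x; y] X <-> ~ eval cp [x; y] X) ->
  (forall x y z, eval cp [x; y] X -> eval cp [y; z] X -> eval cp [x; z] X) ->
  unbounded (fun x => G x = true) /\
  homogeneous (fun x y => eval cp [x; y] X) (fun x => G x = true).

Lemma upd_self X j : upd X j (X j) = X.
Proof.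
  apply functional_extensionality; intros i. unfold upd.
  destruct Nat.eq_dec; congruence.
Qed.

Lemma solve_instance cp cn X j : 2 <= j -> Good X ->
  exists G, Good (upd X j G) /\ solves cp cn X G.
Proof.
  intros Hj HX.
  destruct (classic ((forall x y, eval cn [x; y] X <-> ~ eval cp [x; y] X) /\
    (forall x y z, eval cp [x; y] X -> eval cp [y; z] X -> eval cp [x; z] X)))
    as [[Hn Tr]|N].
  - destruct (solve_poset X (fun x y => eval cp [x; y] X) j) as (G & U & H & HG); auto.
    + exists cp. reflexivity.
    + exists cn. intros x y. symmetry; auto.
    + exists G. split; auto. intros _ _. auto.
  - exists (X j). rewrite upd_self. split; auto. intros H1 H2. exfalso; auto.
Qed.

Definition solvable (X : nat -> nat -> bool) : Prop :=
  forall cp cn, exists i, solves cp cn X (X i).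

Lemma solve_all X0 : Good X0 -> exists X, Good X /\ X 0 = X0 0 /\ X 1 = X0 1 /\ solvable X.
Proof.
  intros H0.
  pose (cp := fun m => dec (fst (of_nat (fst (of_nat m))))).
  pose (cn := fun m => dec (snd (of_nat (fst (of_nat m))))).
  pose (F := fun m X => epsilon (inhabits (fun _ : nat => false))
    (fun G => Good (upd X (2 + m) G) /\ solves (cp m) (cn m) X G)).
  assert (HF : forall m X, Good X ->
    Good (upd X (2 + m) (F m X)) /\ solves (cp m) (cn m) X (F m X)).
  { intros m X HX. apply (epsilon_spec (inhabits (fun _ : nat => false))
      (fun G => Good (upd X (2 + m) G) /\ solves (cp m) (cn m) X G)).
    apply solve_instance; auto; lia. }
  pose (Y := fix Y m := match m with
    0 => X0 | S m => upd (Y m) (2 + m) (F m (Y m)) end).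
  assert (HY : forall m, Good (Y m)).
  { induction m; auto. apply HF; auto. }
  assert (St : forall k m i, i < 2 + m -> Y (k + m) i = Y m i).
  { induction k; intros m i Hi; auto. cbn [Nat.add Y]. fold Y.
    rewrite upd_neq by lia. apply IHk; auto. }
  (* Stage m changes only oracle 2 + m, so oracle i is already final in [Y i]. *)
  pose (X := fun i => Y i i).
  assert (XY : forall m i, i < 2 + m -> X i = Y m i).
  { intros m i Hi. unfold X. rewrite <- (St m i i), <- (St i m i) by lia.
    f_equal; lia. }
  exists X. split; [|split; [|split]].
  - intros c Hc. destruct (eval_supp c) as [N HN].
    assert (E : forall l, eval c l X <-> eval c l (Y N)).
    { intros l. apply HN. intros i Hi. apply XY; lia. }
    destruct (HY N c) as (n & d & Ev & Wd).
    + intros n. destruct (Hc n) as (d & Bd & Ev). exists d. rewrite <- E. auto.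
    + exists n, d. rewrite E. split; auto. unfold W in *. rewrite (XY N) by lia. auto.
  - apply (XY 0 0); lia.
  - apply (XY 0 1); lia.
  - intros c c'. destruct (eval_supp c) as [N HN], (eval_supp c') as [N' HN'].
    (* The padding N + N' makes m exceed the index of every oracle mentioned by the two codes, so
       the instance is the same over [Y m] as over [X]. *)
    set (m := to_nat (to_nat (enc c, enc c'), N + N')).
    assert (Lm : N + N' <= m).
    { pose proof (to_nat_non_decreasing (to_nat (enc c, enc c')) (N + N')). lia. }
    assert (E : forall l, eval c l X <-> eval c l (Y m)).
    { intros l. apply HN. intros i Hi. apply XY; lia. }
    assert (E' : forall l, eval c' l X <-> eval c' l (Y m)).
    { intros l. apply HN'. intros i Hi. apply XY; lia. }
    assert (Ec : cp m = c) by
      (unfold cp, m; rewrite cancel_of_to; cbn [fst]; rewrite cancel_of_to; apply dec_enc).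
    assert (Ec' : cn m = c') by
      (unfold cn, m; rewrite cancel_of_to; cbn [fst]; rewrite cancel_of_to; apply dec_enc).
    exists (2 + m). rewrite (XY (S m)) by lia. cbn [Y]. fold Y. rewrite upd_eq.
    destruct (HF m (Y m) (HY m)) as [_ S]. rewrite Ec, Ec' in S.
    intros H1 H2. destruct S as [U Hom].
    + intros x y. rewrite <- E, <- E'. auto.
    + intros x y z. rewrite <- !E. apply H2.
    + split; auto.
      destruct Hom as [H|[H|H]]; [left|right; left|right; right]; intros x y Hx Hy L;
        specialize (H x y Hx Hy L); cbv beta in *; rewrite ?E; auto.
Qed.

(** The analogue of computability from finitely many of the oracles: the set and its complement both
    have codes. *)
Definition model (X : nat -> nat -> bool) (Y : nat -> bool) : Prop :=
  exists cp cn, forall n, (Y n = true <-> eval cp [n] X) /\ (Y n = false <-> eval cn [n] X).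

Lemma model_oracle X i : model X (X i).
Proof.
  exists (cMem true (var 0) i), (cMem false (var 0) i). intros n. simpl. split; reflexivity.
Qed.

Lemma model_graph X i : model X (graph (X i)).
Proof.
  exists (cGraph true (var 0) i), (cGraph false (var 0) i). intros n. simpl.
  split; reflexivity.
Qed.

(** Codes have no negation, so a code for the negated formula is carried through the induction;
    implication and the bounded quantifiers need it. *)
Lemma bounded_codes X M p : bounded p -> forall V, (forall i, model X (V i)) ->
  (exists c, forall l, eval c l X <-> sat M l V p) /\
  (exists c, forall l, eval c l X <-> ~ sat M l V p).
Proof.
  induction 1; intros V HV;
    try (destruct (IHbounded1 V HV) as [[c1 H1] [n1 N1]];
         destruct (IHbounded2 V HV) as [[c2 H2] [n2 N2]]);
    try (destruct (IHbounded V HV) as [[c Hc] [n Hn]]).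
  - split.
    + exists (cAnd (cLt s (plus t one)) (cLt t (plus s one))). intros l; simpl; lia.
    + exists (cOr (cLt s t) (cLt t s)). intros l; simpl; lia.
  - split; [exists (cLt s t) | exists (cLt t (plus s one))]; intros l; simpl; lia.
  - destruct (HV X0) as (cp & cn & H). split; [exists (cSub [t] cp)|exists (cSub [t] cn)];
      intros l; simpl; destruct (H (tval l t)) as [Hp Hn]; [symmetry; exact Hp|].
    rewrite <- Hn. destruct (V X0 (tval l t)); intuition congruence.
  - split; [exists (cLt zero zero) | exists (cLt zero one)]; intros l; simpl; lia.
  - split; [exists (cOr n1 c2) | exists (cAnd c1 n2)]; intros l; simpl.
    + rewrite N1, H2. destruct (classic (sat M l V p)); tauto.
    + rewrite H1, N2. destruct (classic (sat M l V p)); tauto.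
  - split; [exists (cAnd c1 c2) | exists (cOr n1 n2)]; intros l; simpl.
    + rewrite H1, H2. tauto.
    + rewrite N1, N2. destruct (classic (sat M l V p)); tauto.
  - split; [exists (cOr c1 c2) | exists (cAnd n1 n2)]; intros l; simpl.
    + rewrite H1, H2. tauto.
    + rewrite N1, N2. tauto.
  - split; [exists (cAllLt t c) | exists (cEx (cAnd (cLt (var 0) (liftT t)) n))];
      intros l; simpl.
    + setoid_rewrite Hc. setoid_rewrite tval_liftT. reflexivity.
    + setoid_rewrite Hn. setoid_rewrite tval_liftT. split.
      * intros [x [Lx Nx]] Hall. auto.
      * intros Nall. apply NNPP; intros N. apply Nall. intros x Lx. apply NNPP; eauto.
  - split; [exists (cEx (cAnd (cLt (var 0) (liftT t)) c)) | exists (cAllLt t n)];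
      intros l; simpl.
    + setoid_rewrite Hc. reflexivity.
    + setoid_rewrite Hn. setoid_rewrite tval_liftT. firstorder.
Qed.

Lemma model_RCA0 X q : RCA0 q -> forall l V, (forall i, model X (V i)) ->
  sat (model X) l V q.
Proof.
  intros H l V HV. destruct H; simpl; try lia.
  (* Numbers are standard, so induction holds for every formula. *)
  - intros [Hz Hs] n. apply sat_instN in Hz. induction n; [exact Hz|].
    apply Hs in IHn. apply (sat_substN _ _ _ _ (S n :: l)) in IHn; [exact IHn|].
    intros [|x]; simpl; [lia|reflexivity].
  - destruct H as (p' & Bp & ->), H0 as (q' & Bq & ->). simpl. intros Hpq.
    destruct (bounded_codes X (model X) p' Bp V HV) as [[cp Hp] _].
    destruct (bounded_codes X (model X) q' Bq V HV) as [_ [cn Hn]].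
    set (Y := of_prop (fun n => exists m, sat (model X) (m :: n :: l) V p')).
    exists Y. split.
    (* The complement gets its code from the equivalent universal formula; the number parameters [l]
       become numerals. *)
    + exists (cEx (cSub (var 0 :: var 1 :: map num l) cp)),
        (cEx (cSub (var 0 :: var 1 :: map num l) cn)).
      intros n. cbn [eval map]. setoid_rewrite tval_nums. setoid_rewrite Hp.
      setoid_rewrite Hn. unfold Y. rewrite of_prop_true, of_prop_false.
      split; [reflexivity|]. destruct (Hpq n) as [H1 H2]. split.
      * intros N. apply NNPP; intros N'. apply N, H2. intros m. apply NNPP; eauto.
      * intros [m Hm] E. apply Hm, H1, E.
    + intros n. unfold Y. rewrite of_prop_true.
      assert (E : forall m, sat (model X) (m :: n :: l) (scons Y V) (liftS p') <->
                            sat (model X) (m :: n :: l) V p') by (intros; apply sat_liftS).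
      fold Y. cbn [liftS substS]. split; intros [m Hm]; exists m; apply E, Hm.
Qed.

(** * Failure of EM *)

Definition transitive_in (t : nat -> nat -> bool) (S : nat -> Prop) : Prop :=
  forall a b c, S a -> S b -> S c -> t a b = true -> t b c = true -> t a c = true.

Lemma unbounded_big (S : nat -> Prop) : unbounded S ->
  forall n, exists d, big n d /\ forall x, In x (ls d) -> S x.
Proof.
  intros H n.
  assert (E : exists l, NoDup l /\ length l = n /\ forall x, In x l -> S x).
  { induction n as [|n (l & ND & L & Hl)].
    - exists []. repeat split; auto; [constructor | intros x []].
    - destruct (H (1 + list_max l)) as (y & Hy & Sy). exists (y :: l).
      repeat split; simpl; auto.
      + constructor; auto. intros Hin. apply le_list_max in Hin. lia.
      + intros x [<-|Hx]; auto. }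
  destruct E as (l & ND & L & Hl). exists (enc_list l). unfold big. rewrite ls_enc.
  rewrite nodup_fixed_point by auto. split; [lia|auto].
Qed.

Lemma no_transitive_set X p S : valid p -> Good X -> X 1 = ground p 1 ->
  ce X S -> unbounded S -> ~ transitive_in (T p) S.
Proof.
  intros V HX E1 [c Hc] U Tr.
  (* The code says that [ls d] is included in [S]. *)
  destruct (HX (cAllIn (var 1) (cSub [var 0] c))) as (n & d & Ev & Wd).
  - intros n. destruct (unbounded_big S U n) as (d & Bd & Sd). exists d. split; auto.
    simpl. intros x Hx. apply Hc; auto.
  - simpl in Ev. setoid_rewrite <- Hc in Ev.
    assert (W (ground p) d) as [s [e Hs]]%ground_W by (unfold W in *; rewrite <- E1; auto).
    (* An element of [S] beyond the stage of the promise closes a cycle inside [S]. *)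
    destruct (U (1 + s)) as (y & Hy & Sy).
    destruct (valid_cuts p s e d y V Hs) as (a & b & Ha & Hb & Tab & Tby & Tya); [lia|].
    pose proof (Tr a b y (Ev a Ha) (Ev b Hb) Sy Tab Tby) as Tay.
    destruct (Nat.eq_dec y a) as [->|Ne].
    + rewrite T_irrefl in Tya. discriminate.
    + rewrite (T_total p y a Ne), Tya in Tay. discriminate.
Qed.

Lemma infinite_unbounded M V Y :
  sat M [] (scons Y V) (is_infinite 0) <-> unbounded (fun x => Y x = true).
Proof.
  simpl. split.
  - intros H b. destruct (H b) as (y & L & Sy). exists y. split; [lia|auto].
  - intros H b. destruct (H (S b)) as (y & L & Sy). exists y. split; [lia|auto].
Qed.

Lemma not_EM X p V : valid p -> Good X -> X 0 = ground p 0 -> X 1 = ground p 1 ->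
  ~ sat (model X) [] V EM.
Proof.
  intros Vp HX E0 E1 H.
  assert (HT : forall x y, X 0 (pr x y) = T p x y) by (intros; rewrite E0; apply ground_T).
  destruct (H (X 0) (model_oracle X 0)) as (S & (cp & cn & MS) & Inf & Tr).
  - split; simpl.
    + intros n. fold (pr n n). rewrite HT, T_irrefl. discriminate.
    + intros a b Hab. fold (pr a b) (pr b a). rewrite !HT, (T_total p a b) by auto.
      destruct (T p a b); simpl; intuition discriminate.
  - apply infinite_unbounded in Inf.
    apply (no_transitive_set X p (fun x => S x = true) Vp HX E1); auto.
    + exists cp. apply MS.
    + intros a b c Sa Sb Sc. rewrite <- !HT. intros Hab Hbc.
      apply (Tr a b c); auto.
Qed.

(** * CAC and ADS in the model *)

Lemma solve_relation X P : solvable X -> model X P ->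
  (forall x y z, P (pr x y) = true -> P (pr y z) = true -> P (pr x z) = true) ->
  exists i, unbounded (fun x => X i x = true) /\
    homogeneous (fun x y => P (pr x y) = true) (fun x => X i x = true).
Proof.
  intros HX (cp & cn & H) Tr.
  assert (Hp : forall x y, P (pr x y) = true <->
    eval (cSub [pairT (var 0) (var 1)] cp) [x; y] X) by (intros; apply H).
  assert (Hn : forall x y, P (pr x y) = false <->
    eval (cSub [pairT (var 0) (var 1)] cn) [x; y] X) by (intros; apply H).
  destruct (HX (cSub [pairT (var 0) (var 1)] cp) (cSub [pairT (var 0) (var 1)] cn))
    as [i Hi].
  destruct Hi as [U Hom].
  - intros x y. rewrite <- Hp, <- Hn. destruct (P (pr x y)); intuition discriminate.
  - intros x y z. rewrite <- !Hp. apply Tr.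
  - exists i. split; auto.
    destruct Hom as [K|[K|K]]; [left|right; left|right; right]; intros x y Hx Hy L;
      specialize (K x y Hx Hy L); cbv beta in *; rewrite ?Hp; auto.
Qed.

Lemma model_CAC X V : solvable X -> sat (model X) [] V CAC.
Proof.
  intros HX P MP (Rf & An & Tr).
  assert (Tr' : forall x y z, P (pr x y) = true -> P (pr y z) = true -> P (pr x z) = true).
  { intros x y z H1 H2. apply (Tr x y z); split; auto. }
  destruct (solve_relation X P HX MP Tr') as (i & U & Hom).
  exists (X i). split; [apply model_oracle|]. split; [apply infinite_unbounded, U|].
  destruct Hom as [H|[H|H]]; [left|left|right]; simpl.
  - intros x y [Hx Hy]. fold (pr x y) (pr y x).
    destruct (Nat.lt_trichotomy x y) as [L|[->|L]]; [|left; apply Rf|]; auto.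
  - intros x y [Hx Hy]. fold (pr x y) (pr y x).
    destruct (Nat.lt_trichotomy x y) as [L|[->|L]]; [|left; apply Rf|]; auto.
  - intros x y (Hx & Hy & Ne). fold (pr x y) (pr y x).
    assert (x < y \/ y < x) as [L|L] by lia;
      [destruct (H x y Hx Hy L) | destruct (H y x Hy Hx L)]; tauto.
Qed.

Lemma count_S S y : count S (1 + y) = count S y + (if S y then 1 else 0).
Proof.
  unfold count. rewrite seq_S, filter_app, length_app. simpl. destruct (S y); auto.
Qed.

Lemma count_mono S x y : x <= y -> count S x <= count S y.
Proof.
  intros H. induction H as [|y H IH]; auto. pose proof (count_S S y). simpl in *. lia.
Qed.

Lemma count_lt S x y : S x = true -> x < y -> count S x < count S y.
Proof.
  intros Hx L. pose proof (count_mono S (1 + x) y L). rewrite count_S, Hx in H. lia.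
Qed.

Lemma graph_pr S n y : graph S (pr n y) = true <-> S y = true /\ count S y = n.
Proof.
  unfold graph. rewrite unpr_pr, Bool.andb_true_iff, Nat.eqb_eq. reflexivity.
Qed.

Lemma graph_total S : unbounded (fun x => S x = true) ->
  forall n, exists y, S y = true /\ count S y = n.
Proof.
  intros U n.
  (* The next element of [S] from b on has the same count as b. *)
  assert (Next : forall m b, b <= m -> S m = true ->
    exists y, b <= y /\ S y = true /\ count S y = count S b).
  { intros m b. remember (m - b) as k eqn:Ek. revert b Ek.
    induction k as [|k IH]; intros b Ek Lb Sm.
    - exists m. replace b with m by lia. auto.
    - destruct (S b) eqn:Sb; [exists b; auto|].
      destruct (IH (1 + b)) as (y & Ly & Sy & Cy); [lia|lia|auto|].
      exists y. split; [lia|]. split; auto. rewrite Cy, count_S, Sb. lia. }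
  induction n as [|n (y & Sy & Cy)].
  - destruct (U 0) as (m & Lm & Sm). destruct (Next m 0 Lm Sm) as (y & _ & H). eauto.
  - destruct (U (1 + y)) as (m & Lm & Sm).
    destruct (Next m (1 + y) Lm Sm) as (z & _ & Sz & Cz). exists z. split; auto.
    rewrite Cz, count_S, Sy. lia.
Qed.

Lemma graph_increasing S n m x y :
  graph S (pr n x) = true -> graph S (pr m y) = true -> n < m -> x < y.
Proof.
  rewrite !graph_pr. intros [Sx <-] [Sy <-] L.
  destruct (le_lt_dec y x) as [H|H]; auto. apply (count_mono S) in H. lia.
Qed.

(** The increasing enumeration of a homogeneous set is the required monotone sequence; totality
    rules out an infinite antichain. *)
Lemma model_ADS X V : solvable X -> sat (model X) [] V ADS.
Proof.
  intros HX P MP (Irr & Tr & Tot).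
  assert (Tr' : forall x y z, P (pr x y) = true -> P (pr y z) = true -> P (pr x z) = true).
  { intros x y z H1 H2. apply (Tr x y z); split; auto. }
  destruct (solve_relation X P HX MP Tr') as (i & U & Hom).
  exists (graph (X i)). split; [apply model_graph|]. split.
  - split; simpl.
    + intros n. destruct (graph_total (X i) U n) as (y & Hy). exists y.
      apply graph_pr, Hy.
    + intros n x y [H1 H2]. fold (pr n x) in H1. fold (pr n y) in H2.
      apply graph_pr in H1 as [S1 C1]. apply graph_pr in H2 as [S2 C2].
      destruct (Nat.lt_trichotomy x y) as [L|[L|L]]; auto.
      * apply (count_lt (X i)) in L; auto; lia.
      * apply (count_lt (X i)) in L; auto; lia.
  - destruct Hom as [H|[H|H]].
    + left. simpl. intros n m x y (L & Hx & Hy).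
      pose proof (graph_increasing _ _ _ _ _ Hx Hy L).
      apply graph_pr in Hx as []. apply graph_pr in Hy as []. apply H; auto.
    + right. simpl. intros n m x y (L & Hx & Hy).
      pose proof (graph_increasing _ _ _ _ _ Hx Hy L).
      apply graph_pr in Hx as []. apply graph_pr in Hy as []. apply (H x y); auto.
    + exfalso. destruct (U 0) as (x & _ & Hx). destruct (U (1 + x)) as (y & L & Hy).
      destruct (H x y Hx Hy L) as [N1 N2].
      destruct (Tot x y) as [K|[K|K]]; [auto|simpl in K; lia|auto].
Qed.

Theorem corollary1p12 :
  ~ proves_over RCA0 CAC EM /\ ~ proves_over RCA0 ADS EM.
Proof.
  destruct good_ground as (p & Vp & Gp).
  destruct (solve_all (ground p) Gp) as (X & GX & E0 & E1 & HX).
  assert (H : forall q, (forall V, sat (model X) [] V q) ->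
                (forall l V, sat (model X) l V q <-> sat (model X) [] V q) ->
                ~ proves_over RCA0 q EM).
  { intros q Hq Hl D. apply (not_EM X p (fun _ => X 0) Vp GX E0 E1).
    apply (soundness (model X) (fun r => RCA0 r \/ r = q) [] EM); auto.
    - intros r [Hr| ->] l V HV; [apply model_RCA0; auto | apply Hl; auto].
    - intros _. apply model_oracle.
    - intros r []. }
  split; apply H.
  - intros V. exact (model_CAC X V HX).
  (* [CAC] is closed: each number variable looks up a bound value, so both sides are convertible. *)
  - reflexivity.
  - intros V. exact (model_ADS X V HX).
  - reflexivity.
Qed.
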